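(* The finite adèle group $\mathbb{A}_f$ is selfdual. That is, the map $\mathbb{A}_f\to\mathrm{Char}(\mathbb{A}_f)$ given by $\xi\mapsto\chi_\xi$, where $\chi_\xi(x)=\chi(\xi x)$, is an isomorphism of locally compact Abelian topological groups.
   Context: $\mathbb{A}_f$ is the ring of finite adèles of $\mathbb{Q}$ and $\widehat{\mathbb{Z}}=\prod_p\mathbb{Z}_p\subset\mathbb{A}_f$ its maximal compact open subring. For $x\in\mathbb{A}_f$, the fractional part $\{x\}$ is the unique rational number in $[0,1)$ with $x-\{x\}\in\widehat{\mathbb{Z}}$. The canonical additive character is $\chi:\mathbb{A}_f\to\mathbb{S}^1$, $\chi(x)=\exp(2\pi i\{x\})$, where $\mathbb{S}^1$ is the group of complex numbers of absolute value one. $\mathrm{Char}(\mathbb{A}_f)$ is the Pontryagin dual: the group of all continuous homomorphisms $(\mathbb{A}_f,+)\to\mathbb{S}^1$ with the compact-open topology. *)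

(* Defs.v *)
From HB Require Import structures.
From mathcomp Require Import all_boot all_order all_algebra.
From mathcomp Require Import ring_quotient.
From mathcomp Require Import complex ring.
From mathcomp Require Import all_classical all_reals all_analysis.

Set Implicit Arguments.
Unset Strict Implicit.
Unset Printing Implicit Defensive.

Import Order.TTheory GRing.Theory Num.Theory.
Import numFieldNormedType.Exports.

Local Open Scope classical_set_scope.
Local Open Scope ring_scope.

Definition prime_nat := {p : nat | prime p}.
HB.instance Definition _ := Choice.on prime_nat.

Section PadicNorm.
Variable p : prime_nat.

Definition padic_norm (x : rat) : rat :=
  if x == 0 then 0
  else (val p)%:R ^ ((logn (val p) `|denq x|)%:Z - (logn (val p) `|numq x|)%:Z).

Let p_pr : prime (val p). Proof. exact: valP. Qed.
Let p_gt0 : 0 < (val p)%:R :> rat. Proof. by rewrite ltr0n prime_gt0. Qed.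
Let p_gt1 : 1 < (val p)%:R :> rat. Proof. by rewrite ltr1n prime_gt1. Qed.

Lemma padic_norm0 : padic_norm 0 = 0.
Proof. by rewrite /padic_norm eqxx. Qed.

Lemma padic_norm_ge0 x : 0 <= padic_norm x.
Proof. by rewrite /padic_norm; case: ifP => // _; rewrite exprz_ge0 // ltW. Qed.

Lemma padic_norm_eq0 x : (padic_norm x == 0) = (x == 0).
Proof.
rewrite /padic_norm; case: ifP => [|_]; first by rewrite eqxx.
by rewrite gt_eqF // exprz_gt0.
Qed.

Lemma padic_norm_frac (a b : int) : a != 0 -> b != 0 ->
  padic_norm (a%:~R / b%:~R) =
  (val p)%:R ^ ((logn (val p) `|b|)%:Z - (logn (val p) `|a|)%:Z).
Proof.
move=> a0 b0; set x : rat := a%:~R / b%:~R.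
have bQ0 : b%:~R != 0 :> rat by rewrite intr_eq0.
have x0 : x != 0 by rewrite mulf_neq0 ?invr_eq0 ?intr_eq0.
rewrite /padic_norm (negPf x0).
have e : (numq x * b = a * denq x)%R.
  apply: (@intr_inj rat); rewrite !rmorphM /= numqE.
  by rewrite -mulrA [X in _ * X]mulrC mulrA /x mulfVK.
have /(congr1 absz) := e; rewrite !abszM => /(congr1 (logn (val p))).
have n0 : numq x != 0 by rewrite numq_eq0.
rewrite !lognM ?absz_gt0 ?denq_neq0 // => /(congr1 Posz); rewrite !PoszD => h.
congr (_ ^ _); apply/eqP.
by rewrite subr_eq addrAC eq_sym subr_eq addrC h addrC eqxx.
Qed.

Lemma padic_norm1 : padic_norm 1 = 1.
Proof. by rewrite /padic_norm oner_eq0 /= logn1 subrr expr0z. Qed.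

Lemma padic_normM x y : padic_norm (x * y) = padic_norm x * padic_norm y.
Proof.
have [->|x0] := eqVneq x 0; first by rewrite mul0r padic_norm0 mul0r.
have [->|y0] := eqVneq y 0; first by rewrite mulr0 padic_norm0 mulr0.
rewrite -[in LHS](divq_num_den x) -[in LHS](divq_num_den y) mulf_div -!rmorphM /=.
rewrite padic_norm_frac ?mulf_neq0 ?numq_eq0 ?denq_neq0 //.
rewrite !abszM !lognM ?absz_gt0 ?numq_eq0 ?denq_neq0 //.
rewrite /padic_norm (negPf x0) (negPf y0) -expfzDr ?gt_eqF //.
by congr (_ ^ _); rewrite !PoszD opprD addrACA.
Qed.

Lemma padic_normN x : padic_norm (- x) = padic_norm x.
Proof. by rewrite /padic_norm oppr_eq0 numqN denqN abszN. Qed.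

Lemma padic_normB x y : padic_norm (x - y) = padic_norm (y - x).
Proof. by rewrite -padic_normN opprB. Qed.

Lemma padic_norm_le1 (a : int) : padic_norm a%:~R <= 1.
Proof.
have [->|a0] := eqVneq a 0; first by rewrite padic_norm0.
rewrite -[a%:~R]divr1 -[1]/(1%:~R) padic_norm_frac //= logn1 sub0r.
by rewrite -invr_expz invf_le1 ?exprz_gt0 // exprn_ege1 // ltW.
Qed.

Lemma padic_norm1D x : padic_norm x <= 1 -> padic_norm (1 + x) <= 1.
Proof.
have [->|x0] := eqVneq x 0; first by rewrite addr0 padic_norm1.
move=> x1; have [->|sx0] := eqVneq (1 + x) 0; first by rewrite padic_norm0.
have d0 : logn (val p) `|denq x| = 0%N.
  apply/eqP/contraT; rewrite -lt0n logn_gt0 mem_primes => /and3P[_ _ pd].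
  have pn : ~~ (val p %| `|numq x|)%N.
    apply/negP => pn; have := coprime_num_den x; rewrite /coprime => /eqP g1.
    have := dvdn_gcd (val p) `|numq x| `|denq x|.
    by rewrite pn pd g1 dvdn1 => /eqP p1; move: p_pr; rewrite p1.
  move: x1; rewrite /padic_norm (negPf x0) (@lognE _ `|numq x|) (negPf pn) !andbF.
  rewrite /= subr0 leNgt -exprnP exprn_egt1 //.
  by rewrite -lt0n logn_gt0 mem_primes p_pr pd absz_gt0 denq_neq0.
have e : 1 + x = (denq x + numq x)%:~R / (denq x)%:~R.
  rewrite rmorphD /= mulrDl divff ?intr_eq0 ?denq_neq0 //.
  by rewrite divq_num_den.
have s0 : denq x + numq x != 0.
  by apply: contraNneq sx0 => s0; rewrite e s0 mul0r.
rewrite e padic_norm_frac ?denq_neq0 // d0 sub0r.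
by rewrite -invr_expz invf_le1 ?exprz_gt0 // exprn_ege1 // ltW.
Qed.

Lemma padic_normD x y :
  padic_norm (x + y) <= Num.max (padic_norm x) (padic_norm y).
Proof.
wlog xy : x y / padic_norm x <= padic_norm y.
  by move=> H; case: (leP (padic_norm x) (padic_norm y)) => h;
    [rewrite -(max_r h)|rewrite -(max_l (ltW h)) addrC maxC]; apply: H => //;
    exact: ltW.
rewrite (max_r xy).
have [y0|y0] := eqVneq y 0.
  have : padic_norm x == 0.
    by rewrite eq_le padic_norm_ge0 andbT -padic_norm0 -y0.
  by rewrite padic_norm_eq0 => /eqP ->; rewrite add0r.
have -> : x + y = y * (1 + x / y) by rewrite mulrDr mulr1 mulrCA divff // mulr1 addrC.
rewrite padic_normM ler_piMr ?padic_norm_ge0 // padic_norm1D //.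
have yn0 : 0 < padic_norm y by rewrite lt0r padic_norm_eq0 y0 padic_norm_ge0.
by rewrite -(ler_pM2l yn0) -padic_normM mulrCA divff // !mulr1.
Qed.

Lemma padic_norm_dist x y z e :
  padic_norm (x - y) < e -> padic_norm (y - z) < e -> padic_norm (x - z) < e.
Proof.
move=> xy yz; rewrite -(subrK y x) -addrA.
by apply: le_lt_trans (padic_normD _ _) _; rewrite gt_max xy yz.
Qed.

Lemma padic_norm_eq x y : padic_norm (x - y) < padic_norm x ->
  padic_norm y = padic_norm x.
Proof.
move=> h; apply/eqP; rewrite eq_le; apply/andP; split.
  have := padic_normD x (y - x); rewrite addrC subrK => /le_trans; apply.
  by rewrite ge_max lexx padic_normB ltW.
have := padic_normD (x - y) y; rewrite subrK.
by case: (leP (padic_norm (x - y)) (padic_norm y)) => // _; rewrite leNgt h.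
Qed.

Definition padic_cauchy : {pred nat -> rat} := fun u =>
  `[< forall e : rat, 0 < e -> exists N, forall m n, (N <= m)%N -> (N <= n)%N ->
      padic_norm (u m - u n) < e >].

Lemma padic_cauchyP u : reflect
  (forall e : rat, 0 < e -> exists N, forall m n, (N <= m)%N -> (N <= n)%N ->
      padic_norm (u m - u n) < e) (u \in padic_cauchy).
Proof. exact: asboolP. Qed.

Lemma padic_cauchy_bounded u : u \in padic_cauchy ->
  exists2 M : rat, 0 < M & exists N, forall n, (N <= n)%N -> padic_norm (u n) < M.
Proof.
move=> /padic_cauchyP /(_ 1 ltr01)[N uN].
exists (1 + padic_norm (u N)); first by rewrite ltr_wpDr ?padic_norm_ge0.
exists N => n Nn; rewrite -(subrK (u N) (u n)).
apply: le_lt_trans (padic_normD _ _) _.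
rewrite gt_max ltrDr ltr01 andbT ltr_wpDr ?padic_norm_ge0 //.
exact: uN.
Qed.

Lemma padic_cauchy_subring : subring_closed padic_cauchy.
Proof.
split => [|u v /padic_cauchyP uC /padic_cauchyP vC|u v uC vC]; apply/padic_cauchyP => e e0.
- by exists 0%N => m n _ _; rewrite subrr padic_norm0.
- have [N uN] := uC e e0; have [M vM] := vC e e0.
  exists (maxn N M) => m n; rewrite !geq_max => /andP[? ?] /andP[? ?].
  have -> : (u - v) m - (u - v) n = (u m - u n) + (v n - v m).
    by rewrite !fctE; ring.
  apply: le_lt_trans (padic_normD _ _) _.
  by rewrite gt_max uN //= vM.
have [A A0 [N1 uA]] := padic_cauchy_bounded uC.
have [B B0 [N2 vB]] := padic_cauchy_bounded vC.
have /padic_cauchyP/(_ _ (divr_gt0 e0 B0))[N3 uN] := uC.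
have /padic_cauchyP/(_ _ (divr_gt0 e0 A0))[N4 vN] := vC.
exists (maxn (maxn N1 N2) (maxn N3 N4)) => m n.
rewrite !geq_max => /andP[/andP[? ?] /andP[? ?]] /andP[/andP[? ?] /andP[? ?]].
have -> : (u * v) m - (u * v) n = u m * (v m - v n) + (u m - u n) * v n.
  by rewrite !fctE; ring.
apply: le_lt_trans (padic_normD _ _) _; rewrite !padic_normM gt_max.
apply/andP; split.
  by rewrite -(divfK (lt0r_neq0 A0) e) mulrC ltr_pM ?padic_norm_ge0 ?uA // vN.
by rewrite -(divfK (lt0r_neq0 B0) e) ltr_pM ?padic_norm_ge0 ?vB // uN.
Qed.

HB.instance Definition _ :=
  GRing.isSubringClosed.Build (nat -> rat) padic_cauchy padic_cauchy_subring.

Definition cauchy_seq := {u : nat -> rat | u \in padic_cauchy}.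
HB.instance Definition _ := SubChoice.on cauchy_seq.
HB.instance Definition _ := [SubChoice_isSubComNzRing of cauchy_seq by <:].

Definition padic_null : {pred cauchy_seq} := fun u =>
  `[< forall e : rat, 0 < e -> exists N, forall n, (N <= n)%N ->
      padic_norm (val u n) < e >].

Lemma padic_nullP u : reflect
  (forall e : rat, 0 < e -> exists N, forall n, (N <= n)%N ->
      padic_norm (val u n) < e) (u \in padic_null).
Proof. exact: asboolP. Qed.

Lemma padic_null_idealr : idealr_closed padic_null.
Proof.
split => [||u v w /padic_nullP vN /padic_nullP wN].
- by apply/padic_nullP => e e0; exists 0%N => n _; rewrite /= padic_norm0.
- apply/padic_nullP => /(_ 1 ltr01)[N /(_ N (leqnn N))].
  by rewrite /= padic_norm1 ltxx.
apply/padic_nullP => e e0.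
have [A A0 [N uA]] := padic_cauchy_bounded (valP u).
have [M vM] := vN _ (divr_gt0 e0 A0); have [L wL] := wN _ e0.
exists (maxn N (maxn M L)) => n; rewrite !geq_max => /and3P[? ? ?].
have -> : val (u * v + w) n = val u n * val v n + val w n by [].
apply: le_lt_trans (padic_normD _ _) _; rewrite gt_max padic_normM wL // andbT.
by rewrite -(divfK (lt0r_neq0 A0) e) mulrC ltr_pM ?padic_norm_ge0 ?uA // vM.
Qed.

HB.instance Definition _ :=
  isIdealr.Build cauchy_seq padic_null padic_null_idealr.

(* The completion of Q for padic_norm: Cauchy sequences modulo null sequences. *)
Definition Qp := {ideal_quot padic_null}.
HB.instance Definition _ := GRing.ComNzRing.on Qp.

End PadicNorm.

Arguments padic_null : clear implicits.

Local Open Scope quotient_scope.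

Section Qp.
Variable p : prime_nat.
Implicit Types (x y z : Qp p) (u v : cauchy_seq p).

Definition padic_norm_cvg u (a : rat) :=
  forall e : rat, 0 < e -> exists N, forall n, (N <= n)%N ->
    `|padic_norm p (val u n) - a| < e.

(* The norms of the terms of a Cauchy sequence converge in Q, because they are
   eventually constant unless they tend to 0. *)
Definition Qp_norm x : rat := xget 0 [set a | padic_norm_cvg (repr x) a].

Lemma padic_norm_cvg_unique u a b :
  padic_norm_cvg u a -> padic_norm_cvg u b -> a = b.
Proof.
move=> ua ub; apply/eqP; rewrite -subr_eq0 -normr_eq0; apply/contraT => ab.
have e0 : 0 < `|a - b| / 2 by rewrite divr_gt0 // lt0r ab normr_ge0.
have [N uN] := ua _ e0; have [M uM] := ub _ e0.
have := ler_distD (padic_norm p (val u (maxn N M))) a b.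
rewrite leNgt => /negP[]; rewrite [ltRHS]splitr ltrD //.
  by rewrite distrC uN // leq_maxl.
by rewrite uM // leq_maxr.
Qed.

Lemma pi_Qp_eq0 u : (\pi_(Qp p) u == 0) = (u \in padic_null p).
Proof. by rewrite -[X in _ == X]pi_zeror -Quotient.idealrBE subr0. Qed.

Lemma padic_norm_cvg_pi u v a : \pi_(Qp p) u = \pi_(Qp p) v ->
  padic_norm_cvg u a -> padic_norm_cvg v a.
Proof.
move=> uv; have /padic_nullP uvN : u - v \in padic_null p.
  by rewrite Quotient.idealrBE; apply/eqP.
move=> ua e e0; have e20 : 0 < e / 2 by rewrite divr_gt0.
have [N uN] := ua _ e20; have [M vM] := uvN _ e20.
exists (maxn N M) => n; rewrite geq_max => /andP[Nn Mn].
have h : `|padic_norm p (val v n) - padic_norm p (val u n)|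
    <= padic_norm p (val u n - val v n).
  set s := val u n; set t := val v n.
  have [st|] := ltP (padic_norm p (s - t)) (padic_norm p s).
    by rewrite (padic_norm_eq st) subrr normr0 padic_norm_ge0.
  have [ts|ts] := ltP (padic_norm p (s - t)) (padic_norm p t).
    rewrite padic_normB in ts; rewrite (padic_norm_eq ts) subrr normr0.
    by rewrite padic_norm_ge0.
  move=> st; rewrite ler_norml; apply/andP; split.
    by rewrite lerNl opprB lerBlDr ler_wpDr ?padic_norm_ge0.
  by rewrite lerBlDr ler_wpDr ?padic_norm_ge0.
rewrite -(subrK (padic_norm p (val u n)) (padic_norm p (val v n))) -addrA.
rewrite [ltRHS]splitr; apply: le_lt_trans (ler_normD _ _) _.
by rewrite ltrD ?uN // (le_lt_trans h) // vM.
Qed.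

Lemma padic_norm_cvg_evt u a :
  (exists N, forall n, (N <= n)%N -> padic_norm p (val u n) = a) ->
  padic_norm_cvg u a.
Proof. by move=> [N uN] e e0; exists N => n /uN ->; rewrite subrr normr0. Qed.

Lemma padic_norm_evt u : u \notin padic_null p ->
  exists2 a : rat, 0 < a &
    exists N, forall n, (N <= n)%N -> padic_norm p (val u n) = a.
Proof.
move=> /asboolPn/existsNP[e /not_implyP[e0 /forallNP ue]].
have /padic_cauchyP/(_ e e0)[N uN] := valP u.
have /existsNP[n /not_implyP[Nn /negP]] := ue N; rewrite -leNgt => en.
exists (padic_norm p (val u n)); first exact: lt_le_trans en.
exists n => m nm; apply: padic_norm_eq; apply: lt_le_trans en.
by apply: uN => //; exact: leq_trans nm.
Qed.

Lemma Qp_normE u a : padic_norm_cvg u a -> Qp_norm (\pi u) = a.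
Proof.
move=> ua; have ra : padic_norm_cvg (repr (\pi_(Qp p) u)) a.
  by apply: padic_norm_cvg_pi ua; rewrite reprK.
rewrite /Qp_norm; case: xgetP => [b _ /= rb|/(_ a)//].
exact: padic_norm_cvg_unique rb ra.
Qed.

Variant Qp_norm_spec u : bool -> rat -> Prop :=
| QpNormNull : u \in padic_null p -> Qp_norm_spec u true 0
| QpNormPos a N : 0 < a ->
    (forall n, (N <= n)%N -> padic_norm p (val u n) = a) ->
    Qp_norm_spec u false a.

Lemma Qp_normP u : Qp_norm_spec u (\pi_(Qp p) u == 0) (Qp_norm (\pi u)).
Proof.
rewrite pi_Qp_eq0; have [u0|u0] := boolP (u \in _).
  rewrite (@Qp_normE u 0); first by constructor.
  move=> e e0; have /padic_nullP/(_ e e0)[N uN] := u0; exists N => n Nn.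
  by rewrite subr0 ger0_norm ?padic_norm_ge0 // uN.
have [a a0 ua] := padic_norm_evt u0; rewrite (@Qp_normE u a).
  by have [N uN] := ua; apply: QpNormPos uN.
exact: padic_norm_cvg_evt.
Qed.

Lemma Qp_norm_ge0 x : 0 <= Qp_norm x.
Proof. by rewrite -[x]reprK; case: Qp_normP => // a N /ltW. Qed.

Lemma Qp_norm_eq0 x : (Qp_norm x == 0) = (x == 0).
Proof.
by rewrite -[x]reprK; case: Qp_normP => [_|a N /gt_eqF]; rewrite ?eqxx.
Qed.

Lemma Qp_norm0 : Qp_norm 0 = 0.
Proof. by apply/eqP; rewrite Qp_norm_eq0. Qed.

Lemma Qp_norm_le u b : 0 < b ->
  (exists N, forall n, (N <= n)%N -> padic_norm p (val u n) <= b) ->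
  Qp_norm (\pi u) <= b.
Proof.
move=> b0 [N uN]; case: Qp_normP => [_|a M a0 uM]; first exact: ltW.
by rewrite -(uM (maxn M N)) ?leq_maxl // uN // leq_maxr.
Qed.

Lemma Qp_le_norm u b : 0 < b -> Qp_norm (\pi u) <= b ->
  exists N, forall n, (N <= n)%N -> padic_norm p (val u n) <= b.
Proof.
move=> b0; case: Qp_normP => [/padic_nullP/(_ b b0)[N uN] _|a N _ uN ab].
  by exists N => n /uN/ltW.
by exists N => n /uN ->.
Qed.

Lemma Qp_normN x : Qp_norm (- x) = Qp_norm x.
Proof.
suff H y : Qp_norm (- y) <= Qp_norm y.
  by apply/eqP; rewrite eq_le H /= -[in leLHS](opprK x) H.
have [->|y0] := eqVneq y 0; first by rewrite oppr0.
have n0 : 0 < Qp_norm y by rewrite lt0r Qp_norm_eq0 y0 Qp_norm_ge0.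
rewrite -[y in - y]reprK -(raddfN (\pi_(Qp p))); apply: Qp_norm_le => //.
have [|N yN] := @Qp_le_norm (repr y) _ n0; first by rewrite reprK.
by exists N => n /yN; rewrite -(padic_normN p (val (repr y) n)).
Qed.

Lemma Qp_normD x y : Qp_norm (x + y) <= Num.max (Qp_norm x) (Qp_norm y).
Proof.
set b := Num.max _ _; have [b0|] := ltP 0 b; last first.
  rewrite ge_max => /andP[x0 y0].
  have : x == 0 by rewrite -Qp_norm_eq0 eq_le x0 Qp_norm_ge0.
  have : y == 0 by rewrite -Qp_norm_eq0 eq_le y0 Qp_norm_ge0.
  by move=> /eqP y00 _; rewrite y00 addr0 /b le_max lexx.
have [|N xN] := @Qp_le_norm (repr x) b b0; first by rewrite reprK le_max lexx.
have [|M yM] := @Qp_le_norm (repr y) b b0.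
  by rewrite reprK le_max lexx orbT.
rewrite -[x in leLHS]reprK -[y in leLHS]reprK -(raddfD (\pi_(Qp p))).
apply: Qp_norm_le => //; exists (maxn N M) => n; rewrite geq_max => /andP[? ?].
by apply: le_trans (padic_normD _ _ _) _; rewrite ge_max xN // yM.
Qed.

Lemma Qp_normM x y : Qp_norm (x * y) = Qp_norm x * Qp_norm y.
Proof.
have [->|x0] := eqVneq x 0; first by rewrite mul0r Qp_norm0 mul0r.
have [->|y0] := eqVneq y 0; first by rewrite mulr0 Qp_norm0 mulr0.
move: x0 y0; rewrite -[x]reprK -[y]reprK.
case: Qp_normP => // a N a0 uN; case: Qp_normP => // b M b0 vM _ _.
rewrite -(rmorphM (\pi_(Qp p))); apply: Qp_normE; apply: padic_norm_cvg_evt.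
exists (maxn N M) => n; rewrite geq_max => /andP[? ?].
by rewrite -(uN n) // -(vM n) // -padic_normM.
Qed.

Lemma Qp_norm1 : Qp_norm 1 = 1.
Proof.
rewrite -(rmorph1 (\pi_(Qp p))); apply: Qp_normE; apply: padic_norm_cvg_evt.
by exists 0%N => n _; exact: padic_norm1.
Qed.

Let dist x y := Qp_norm (x - y).

Let dist_xx x : dist x x = 0.
Proof. by rewrite /dist subrr Qp_norm0. Qed.

Let dist_eq0 x y : dist x y = 0 -> x = y.
Proof. by move/eqP; rewrite Qp_norm_eq0 subr_eq0 => /eqP. Qed.

Let dist_sym x y : dist x y = dist y x.
Proof. by rewrite /dist -Qp_normN opprB. Qed.

Let dist_triangle y x z : dist x z <= dist x y + dist y z.
Proof.
rewrite /dist -(subrK y x) -addrA; apply: le_trans (Qp_normD _ _) _.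
by rewrite subrK ge_max lerDl lerDr !Qp_norm_ge0.
Qed.

HB.instance Definition _ :=
  isMetric.Build rat (Qp p) dist_xx dist_eq0 dist_sym dist_triangle.

Definition padic_integers : set (Qp p) := [set x | Qp_norm x <= 1].

Lemma padic_integers1 : padic_integers 1. Proof. by rewrite /padic_integers /= Qp_norm1. Qed.

Lemma padic_integersB x y : padic_integers x -> padic_integers y -> padic_integers (x - y).
Proof.
move=> Zx Zy; apply: le_trans (Qp_normD _ _) _.
by rewrite ge_max Qp_normN Zx.
Qed.

Lemma padic_integersM x y : padic_integers x -> padic_integers y -> padic_integers (x * y).
Proof. by move=> Zx Zy; rewrite /padic_integers /= Qp_normM mulr_ile1 ?Qp_norm_ge0. Qed.

Lemma open_padic_integers : open padic_integers.
Proof.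
rewrite openE => x Zx; apply/nbhs_ballP; exists 1 => //= y.
rewrite ballEmdist /= => xy; rewrite -(subKr x y); apply: padic_integersB => //.
exact: ltW.
Qed.

End Qp.

Lemma prime_nat_two_subproof : prime 2. Proof. by []. Qed.
HB.instance Definition _ := isPointed.Build prime_nat (exist _ 2%N prime_nat_two_subproof).

Definition Qp_prod := forall p : prime_nat, Qp p.
HB.instance Definition _ := gen_eqMixin Qp_prod.
HB.instance Definition _ := gen_choiceMixin Qp_prod.

Section QpProdRing.
Implicit Types x y z : Qp_prod.

Let add x y : Qp_prod := fun p => x p + y p.
Let opp x : Qp_prod := fun p => - x p.
Let mul x y : Qp_prod := fun p => x p * y p.
Let zero : Qp_prod := fun=> 0.
Let one : Qp_prod := fun=> 1.

Let addA : associative add.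
Proof. by move=> x y z; apply: functional_extensionality_dep => p; exact: addrA. Qed.
Let addC : commutative add.
Proof. by move=> x y; apply: functional_extensionality_dep => p; exact: addrC. Qed.
Let add0 : left_id zero add.
Proof. by move=> x; apply: functional_extensionality_dep => p; exact: add0r. Qed.
Let addN : left_inverse zero opp add.
Proof. by move=> x; apply: functional_extensionality_dep => p; exact: addNr. Qed.
Let mulA : associative mul.
Proof. by move=> x y z; apply: functional_extensionality_dep => p; exact: mulrA. Qed.
Let mulC : commutative mul.
Proof. by move=> x y; apply: functional_extensionality_dep => p; exact: mulrC. Qed.
Let mul1 : left_id one mul.
Proof. by move=> x; apply: functional_extensionality_dep => p; exact: mul1r. Qed.
Let mulD : left_distributive mul add.
Proof. by move=> x y z; apply: functional_extensionality_dep => p; exact: mulrDl. Qed.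
Let one_neq0 : one != zero.
Proof.
by apply/eqP => /(congr1 (fun x : Qp_prod => x point))/eqP; rewrite oner_eq0.
Qed.

HB.instance Definition _ := GRing.isZmodule.Build Qp_prod addA addC add0 addN.
HB.instance Definition _ :=
  GRing.Zmodule_isComNzRing.Build Qp_prod mulA mulC mul1 mulD one_neq0.

End QpProdRing.

Definition adelic : {pred Qp_prod} := fun x =>
  `[< finite_set [set p | ~ padic_integers (x p)] >].

Lemma adelicP x : reflect (finite_set [set p | ~ padic_integers (x p)]) (x \in adelic).
Proof. exact: asboolP. Qed.

Lemma adelic_subring : subring_closed adelic.
Proof.
split=> [|x y /adelicP xA /adelicP yA|x y /adelicP xA /adelicP yA]; apply/adelicP.
- rewrite (_ : [set _ | _] = set0); first exact: finite_set0.
  by apply/seteqP; split => // p /=; apply; exact: padic_integers1.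
- apply: (@sub_finite_set _ _ ([set p | ~ padic_integers (x p)] `|` [set p | ~ padic_integers (y p)])).
    move=> p /= xyp; apply: contrapT => /not_orP[/contrapT xp /contrapT yp].
    by apply: xyp; exact: padic_integersB.
  by rewrite finite_setU.
- apply: (@sub_finite_set _ _ ([set p | ~ padic_integers (x p)] `|` [set p | ~ padic_integers (y p)])).
    move=> p /= xyp; apply: contrapT => /not_orP[/contrapT xp /contrapT yp].
    by apply: xyp; exact: padic_integersM.
  by rewrite finite_setU.
Qed.

HB.instance Definition _ :=
  GRing.isSubringClosed.Build Qp_prod adelic adelic_subring.

(* The restricted product of the Q_p with respect to the Z_p. *)
Definition finite_adele := {x : Qp_prod | x \in adelic}.
HB.instance Definition _ := SubChoice.on finite_adele.
HB.instance Definition _ := [SubChoice_isSubComNzRing of finite_adele by <:].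

(* Base of the restricted product topology: boxes of open sets, all but
   finitely many of which are Z_p. *)
Section RestrictedProductTopology.

Let I : pointedType := forall p : prime_nat, set (Qp p).
Let D : set I :=
  [set U | (forall p, open (U p)) /\ finite_set [set p | U p <> @padic_integers p]].
Let b (U : I) : set finite_adele := [set x | forall p, U p (val x p)].

Let b_cover : \bigcup_(U in D) b U = setT.
Proof.
apply/seteqP; split => // x _.
exists (fun p => if pselect (padic_integers (val x p)) then @padic_integers p
                 else setT).
  split=> [p|] /=.
    by case: pselect => [Zx|nZx]; [exact: open_padic_integers|exact: openT].
  apply: sub_finite_set (adelicP _ (valP x)) => p /=.
  by case: pselect.
by move=> p /=; case: pselect.
Qed.

Let b_join U V t : D U -> D V -> b U t -> b V t ->
  exists W, [/\ D W, b W t & b W `<=` b U `&` b V].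
Proof.
move=> [Uo Uf] [Vo Vf] Ut Vt; exists (fun p => U p `&` V p); split.
- split=> [p|]; first exact: openI.
  apply: (@sub_finite_set _ _ ([set p | U p <> @padic_integers p] `|`
                               [set p | V p <> @padic_integers p])).
    move=> p /= UV; apply: contrapT => /not_orP[/contrapT Up /contrapT Vp].
    by apply: UV; rewrite Up Vp setIid.
  by rewrite finite_setU.
- by move=> p; split; [exact: Ut|exact: Vt].
- by move=> x Wx; split => p; have [] := Wx p.
Qed.

HB.instance Definition _ := isBaseTopological.Build finite_adele b_cover b_join.

End RestrictedProductTopology.

Definition Zhat : set finite_adele := [set x | forall p, padic_integers (val x p)].

Lemma padic_norm_rat_le1 (p : prime_nat) (x : rat) :
  (val p %| `|denq x|)%N = false -> padic_norm p x <= 1.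
Proof.
move=> pd; rewrite /padic_norm; case: ifP => // _.
rewrite (@lognE _ `|denq x|) pd !andbF sub0r -invr_expz.
have p0 : 0 < (val p)%:R :> rat by rewrite ltr0n prime_gt0 // (valP p).
by rewrite invf_le1 ?exprz_gt0 // exprn_ege1 // ler1n prime_gt0 // (valP p).
Qed.

Lemma cauchy_cst (p : prime_nat) (x : rat) :
  (fun _ : nat => x) \in padic_cauchy p.
Proof.
by apply/padic_cauchyP => e e0; exists 0%N => m n _ _; rewrite subrr padic_norm0.
Qed.

Definition Qp_of_rat (p : prime_nat) (x : rat) : Qp p :=
  \pi_(Qp p) (Sub (fun=> x) (cauchy_cst p x) : cauchy_seq p).

Lemma adelic_rat (x : rat) : ((fun p => Qp_of_rat p x) : Qp_prod) \in adelic.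
Proof.
apply/adelicP.
apply: (@sub_finite_set _ _ ((val : prime_nat -> nat) @^-1` `I_`|denq x|.+1)).
  move=> p /= xp; apply: contrapT => /negP pd; apply: xp.
  apply: Qp_norm_le => //; exists 0%N => n _ /=.
  apply: padic_norm_rat_le1; apply: contraNF pd => pd.
  by rewrite ltnS dvdn_leq // absz_gt0 denq_neq0.
by apply: finite_preimage; [move=> p q _ _; exact: val_inj|exact: finite_II].
Qed.

Definition adele_of_rat (x : rat) : finite_adele :=
  Sub (fun p => Qp_of_rat p x) (adelic_rat x).

(* Exactly one r satisfies the condition, so the default 0 is never used. *)
Definition frac_part (x : finite_adele) : rat :=
  xget 0 [set r : rat | 0 <= r < 1 /\ Zhat (x - adele_of_rat r)].

Local Open Scope complex_scope.

Section Circle.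
Variable R : realType.

Definition circle : Type := [set z : R[i]^o | `|z| = 1].
HB.instance Definition _ := SubChoice.on circle.
HB.instance Definition _ := Topological.on circle.

Implicit Types z w : circle.

Lemma norm_circle z : `|val z : R[i]^o| = 1.
Proof. exact: set_mem (valP z). Qed.

Lemma val_circle_neq0 z : val z != 0.
Proof. by rewrite -normr_eq0 norm_circle oner_neq0. Qed.

Let mk (z : R[i]^o) (z1 : `|z| = 1) : circle := SigSub (mem_set z1).

Lemma circle_one_subproof : `|1 : R[i]^o| = 1.
Proof. exact: normr1. Qed.
Lemma circle_mul_subproof z w : `|val z * val w : R[i]^o| = 1.
Proof. by rewrite normrM !norm_circle mulr1. Qed.
Lemma circle_inv_subproof z : `|(val z)^-1 : R[i]^o| = 1.
Proof. by rewrite normfV norm_circle invr1. Qed.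

Let one : circle := mk circle_one_subproof.
Let mul z w : circle := mk (circle_mul_subproof z w).
Let inv z : circle := mk (circle_inv_subproof z).

Let mulA : associative mul.
Proof. by move=> z w t; apply: val_inj; rewrite /= mulrA. Qed.
Let mulC : commutative mul.
Proof. by move=> z w; apply: val_inj; rewrite /= mulrC. Qed.
Let mul1 : left_id one mul.
Proof. by move=> z; apply: val_inj; rewrite /= mul1r. Qed.
Let mul_1 : right_id one mul.
Proof. by move=> z; apply: val_inj; rewrite /= mulr1. Qed.
Let mulV : left_inverse one inv mul.
Proof. by move=> z; apply: val_inj; rewrite /= mulVf ?val_circle_neq0. Qed.
Let mul_V : right_inverse one inv mul.
Proof. by move=> z; apply: val_inj; rewrite /= mulfV ?val_circle_neq0. Qed.

HB.instance Definition _ := isGroup.Build circle mulA mul1 mul_1 mulV mul_V.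

Lemma circle_mulC : commutative (@monoid.mul circle).
Proof. exact: mulC. Qed.

Lemma circle_mul_continuous :
  continuous (fun zw : circle * circle => (zw.1 * zw.2)%g).
Proof.
apply: continuous_comp_initial => zw.
apply: (@cvgM R[i]) => /=.
  apply: (@cvg_comp _ _ _ fst (val : circle -> R[i]^o)).
    exact: cvg_fst.
  exact: (@initial_continuous circle).
apply: (@cvg_comp _ _ _ snd (val : circle -> R[i]^o)).
  exact: cvg_snd.
exact: (@initial_continuous circle).
Qed.

Lemma circle_inv_continuous : continuous (fun z : circle => z^-1%g).
Proof.
apply: continuous_comp_initial => z.
apply: (@cvgV R[i] _ (nbhs z) (nbhs_filter z) (val : circle -> R[i]) _
  (val_circle_neq0 z)).
exact: (@initial_continuous _ _ (val : circle -> R[i]^o) z).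
Qed.

Lemma norm_expi (t : R) : `|(cos t +i* sin t : R[i]^o)| = 1.
Proof. by rewrite normc_def cos2Dsin2 sqrtr1. Qed.

Definition expi (t : R) : circle := mk (norm_expi t).

End Circle.

Section PontryaginDual.
Variables (R : realType) (G : PreTopologicalZmodule.type).

Definition is_character (f : G -> circle R) : Prop :=
  continuous f /\ (forall x y, f (x + y) = (f x * f y)%g).

(* As a subtype of {compact-open, G -> circle R}, Char inherits its topology;
   the group law is the pointwise product of characters, written additively. *)
Definition Char : Type :=
  [set f : {compact-open, G -> circle R} | is_character f].
HB.instance Definition _ := SubChoice.on Char.
HB.instance Definition _ := Topological.on Char.

Definition char_fun (f : Char) : G -> circle R := val f.

Lemma char_funP (f : Char) : is_character (char_fun f).
Proof. exact: set_mem (valP f). Qed.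

Implicit Types f g h : Char.

Let mk (f : G -> circle R) (fP : is_character f) : Char :=
  SigSub (mem_set (fP :
    [set f : {compact-open, G -> circle R} | is_character f] f)).

Lemma char_zero_subproof : is_character (fun=> 1%g).
Proof. by split=> [x|x y]; [exact: cvg_cst|rewrite mulg1]. Qed.

Lemma char_add_subproof f g :
  is_character (fun x => (char_fun f x * char_fun g x)%g).
Proof.
have [fC fM] := char_funP f; have [gC gM] := char_funP g; split=> [x|x y].
  apply: (@continuous_comp _ _ _ (fun x => (char_fun f x, char_fun g x))
    (fun zw : circle R * circle R => (zw.1 * zw.2)%g)).
    exact: (cvg_pair (fC x) (gC x)).
  exact: circle_mul_continuous.
by rewrite fM gM !mulgA; congr (_ * _)%g; rewrite -!mulgA [X in (_ * X)%g]circle_mulC.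
Qed.

Lemma char_opp_subproof f : is_character (fun x => ((char_fun f x)^-1)%g).
Proof.
have [fC fM] := char_funP f; split=> [x|x y].
  by apply: (@continuous_comp _ _ _ (char_fun f)); [exact: fC|exact: circle_inv_continuous].
by rewrite fM invgM circle_mulC.
Qed.

Let zero : Char := mk char_zero_subproof.
Let add f g : Char := mk (char_add_subproof f g).
Let opp f : Char := mk (char_opp_subproof f).

Let addA : associative add.
Proof. by move=> f g h; apply/val_inj/funext => x; exact: mulgA. Qed.
Let addC : commutative add.
Proof. by move=> f g; apply/val_inj/funext => x; exact: circle_mulC. Qed.
Let add0 : left_id zero add.
Proof. by move=> f; apply/val_inj/funext => x; exact: mul1g. Qed.
Let addN : left_inverse zero opp add.
Proof. by move=> f; apply/val_inj/funext => x; exact: mulVg. Qed.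

HB.instance Definition _ := GRing.isZmodule.Build Char addA addC add0 addN.

End PontryaginDual.

Definition locally_compact_abelian_group (G : PreTopologicalZmodule.type) : Prop :=
  [/\ continuous (fun xy : G * G => xy.1 - xy.2), hausdorff_space G &
      locally_compact [set: G]].

Definition topological_group_iso (G H : PreTopologicalZmodule.type)
    (f : G -> H) : Prop :=
  [/\ {morph f : x y / x + y >-> x + y}, continuous f &
      exists g : H -> G, [/\ cancel f g, cancel g f & continuous g]].

Definition chi (R : realType) (x : finite_adele) : circle R :=
  expi (2 * pi * ratr (frac_part x)).

(* Main.v *)
From HB Require Import structures.
Require Import Defs.
From mathcomp Require Import all_boot all_order all_algebra.
From mathcomp Require Import complex ring lra.
From mathcomp Require Import all_classical all_reals all_analysis.

(* The fractional ideals N Zhat are a basis of neighbourhoods of 0 in A_f, and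
   A_f = Q + Zhat with Q meeting Zhat in Z; hence chi is a locally constant
   homomorphism with kernel Zhat. The circle has no small subgroups, so a
   character f of A_f is trivial on some N Zhat; after rescaling, on Zhat. Such
   an f is determined by the roots of unity f (1/n!) = exp (2 pi i k_n / n!),
   where the integers k_n are coherent modulo n!: they converge to a xi in Zhat
   with f = chi_xi. Continuity of xi |-> chi_xi holds because a compact set lies
   in some N^-1 Zhat; continuity of the inverse, because N^-1 Zhat is compact and
   two characters that are close on it agree on it. Since A_f is locally compact
   and Hausdorff, so is its dual. *)

Set Implicit Arguments.
Unset Strict Implicit.
Unset Printing Implicit Defensive.

Import Order.TTheory GRing.Theory Num.Theory.
Import numFieldNormedType.Exports.

Local Open Scope classical_set_scope.
Local Open Scope ring_scope.
Local Open Scope quotient_scope.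

(** * Rational approximation of finite adeles *)

Lemma Qp_norm_of_rat (p : prime_nat) (x : rat) :
  Qp_norm (Qp_of_rat p x) = padic_norm p x.
Proof. by apply/Qp_normE/padic_norm_cvg_evt; exists 0%N. Qed.

Lemma Qp_of_rat_is_zmod_morphism p : zmod_morphism (Qp_of_rat p).
Proof.
move=> x y; rewrite /Qp_of_rat -(rmorphB (\pi_(Qp p))).
by congr (\pi_(Qp p) _); apply: val_inj.
Qed.

Lemma Qp_of_rat_is_monoid_morphism p : monoid_morphism (Qp_of_rat p).
Proof.
split=> [|x y].
  by rewrite /Qp_of_rat -(rmorph1 (\pi_(Qp p))); congr (\pi_(Qp p) _); apply: val_inj.
rewrite /Qp_of_rat -(rmorphM (\pi_(Qp p))).
by congr (\pi_(Qp p) _); apply: val_inj.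
Qed.

HB.instance Definition _ p := GRing.isZmodMorphism.Build rat (Qp p)
  (Qp_of_rat p) (Qp_of_rat_is_zmod_morphism p).
HB.instance Definition _ p := GRing.isMonoidMorphism.Build rat (Qp p)
  (Qp_of_rat p) (Qp_of_rat_is_monoid_morphism p).

Lemma adele_eqP (x y : finite_adele) : (forall p, val x p = val y p) -> x = y.
Proof. by move=> xy; apply/val_inj/functional_extensionality_dep. Qed.

Lemma adele_of_rat_is_zmod_morphism : zmod_morphism adele_of_rat.
Proof. by move=> x y; apply: adele_eqP => p; rewrite /= rmorphB. Qed.

Lemma adele_of_rat_is_monoid_morphism : monoid_morphism adele_of_rat.
Proof. by split=> [|x y]; apply: adele_eqP => p; rewrite /= ?rmorph1 ?rmorphM. Qed.

HB.instance Definition _ := GRing.isZmodMorphism.Build rat finite_adele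
  adele_of_rat adele_of_rat_is_zmod_morphism.
HB.instance Definition _ := GRing.isMonoidMorphism.Build rat finite_adele
  adele_of_rat adele_of_rat_is_monoid_morphism.

(** * Norms of rational numbers *)

Lemma padic_norm_gt0 p (x : rat) : (0 < padic_norm p x) = (x != 0).
Proof. by rewrite lt0r padic_norm_eq0 padic_norm_ge0 andbT. Qed.

Lemma padic_normV p (x : rat) : padic_norm p x^-1 = (padic_norm p x)^-1.
Proof.
have [->|x0] := eqVneq x 0; first by rewrite invr0 padic_norm0.
have n0 : padic_norm p x != 0 by rewrite padic_norm_eq0.
by apply: (mulfI n0); rewrite -padic_normM !divff // padic_norm1.
Qed.

Lemma padic_norm_dvd p (x y : rat) :
  y != 0 -> x / y \is a Num.int -> padic_norm p x <= padic_norm p y.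
Proof.
move=> y0 /intrP[k kE]; rewrite -[x](divfK y0) padic_normM kE.
by rewrite ler_piMl ?padic_norm_ge0 // padic_norm_le1.
Qed.

Lemma padic_norm_natX p n :
  padic_norm p ((val p)%:R ^+ n) = (val p)%:R^-1 ^+ n.
Proof.
have p_pr : prime (val p) by exact: valP.
have p0 : (Posz (val p) ^+ n) != 0 by rewrite expf_neq0 // eqz_nat -lt0n prime_gt0.
have -> : (val p)%:R ^+ n = (Posz (val p) ^+ n)%:~R / 1%:~R :> rat.
  by rewrite divr1 rmorphXn.
by rewrite padic_norm_frac // abszX pfactorK // logn1 sub0r exprVn -exprnN.
Qed.

Lemma padic_norm_coprime p (k : int) : coprime (val p) `|k| ->
  padic_norm p k%:~R = 1.
Proof.
move=> pk; have k0 : k != 0.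
  apply: contraTneq pk => ->; rewrite /coprime gcdn0.
  by rewrite neq_ltn prime_gt1 ?orbT //; exact: valP.
have -> : k%:~R = k%:~R / 1%:~R :> rat by rewrite divr1.
by rewrite padic_norm_frac // logn1 logn_coprime.
Qed.

(** A prime divisor of the denominator is coprime to the numerator, so the norm of [x] at that prime
    would exceed 1. *)
Lemma rat_int_padic (x : rat) :
  (forall p, padic_norm p x <= 1) -> x \is a Num.int.
Proof.
move=> x1; suff d1 : denq x = 1.
  by rewrite -[x]divq_num_den d1 divr1.
apply/eqP/contraT => d1; have dgt1 : (1 < `|denq x|)%N.
  by rewrite ltn_neqAle absz_gt0 denq_neq0 andbT eq_sym -eqz_nat absz_denq.
pose p : prime_nat := exist _ (pdiv `|denq x|) (pdiv_prime dgt1).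
have pd : (val p %| `|denq x|)%N by exact: pdiv_dvd.
have x0 : x != 0 by apply: contraNneq d1 => ->.
have pn : coprime (val p) `|numq x|.
  rewrite prime_coprime ?(valP p)//; apply/negP => pn.
  have := coprime_num_den x; rewrite /coprime => /eqP g1.
  have := dvdn_gcd (val p) `|numq x| `|denq x|.
  rewrite pn pd g1 dvdn1 => /eqP p1; have := valP p.
  by rewrite p1.
have := x1 p; rewrite -{1}(divq_num_den x) padic_normM padic_normV.
rewrite padic_norm_coprime // mul1r invf_le1 ?padic_norm_gt0 ?intr_eq0 ?denq_neq0 //.
have -> : (denq x)%:~R = (denq x)%:~R / 1%:~R :> rat by rewrite divr1.
rewrite padic_norm_frac ?denq_neq0 // logn1 sub0r leNgt -invr_expz.
rewrite invf_lt1 ?exprz_gt0 ?ltr0n ?prime_gt0 ?(valP p)//.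
rewrite -exprnP exprn_egt1 ?ltr1n ?prime_gt1 ?(valP p)//.
by rewrite -lt0n logn_gt0 mem_primes (valP p) absz_gt0 denq_neq0 pd.
Qed.

Lemma padic_norm_natX_neq p q n : q != p -> padic_norm q ((val p)%:R ^+ n) = 1.
Proof.
move=> qp; rewrite -natrX pmulrn.
apply: padic_norm_coprime; rewrite absz_nat coprimeXr // prime_coprime ?(valP q)//.
by rewrite dvdn_prime2 ?(valP p) ?(valP q).
Qed.

(* The witness lies in Z[1/p]: if x = a / (p^k m) with c m = 1 modulo p^k,
   it is a c / p^k. *)
Lemma rat_localize p (x : rat) : exists r : rat,
  (forall q, q != p -> padic_norm q r <= 1) /\ padic_norm p (x - r) <= 1.
Proof.
have dgt0 : (0 < `|denq x|)%N by rewrite absz_gt0 denq_neq0.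
have [m pm dE] := pfactor_coprime (valP p) dgt0.
set k := logn _ _ in dE.
have p0 : (val p)%:R != 0 :> rat by rewrite pnatr_eq0 -lt0n prime_gt0 ?(valP p).
have m0 : m%:R != 0 :> rat.
  by rewrite pnatr_eq0 -lt0n; move: dgt0; rewrite dE; case: (m).
have xE : x = (numq x)%:~R / (m%:R * (val p)%:R ^+ k).
  rewrite -[LHS]divq_num_den; congr (_ / _).
  by rewrite -absz_denq -pmulrn dE natrM natrX.
have /coprimezP[[c d] /= cd] : coprimez m (val p ^ k)%N.
  by rewrite coprimezE /= coprime_sym coprimeXl.
have {}cd : c%:~R * m%:R + d%:~R * (val p)%:R ^+ k = 1 :> rat.
  by rewrite -natrX !pmulrn -!rmorphM -rmorphD /= cd.
exists ((numq x)%:~R * c%:~R / (val p)%:R ^+ k); split=> [q qp|].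
  rewrite padic_normM padic_normV padic_norm_natX_neq // divr1.
  by rewrite -rmorphM padic_norm_le1.
have -> : x - (numq x)%:~R * c%:~R / (val p)%:R ^+ k = (numq x * d)%:~R / m%:R.
  rewrite rmorphM /=; have -> : d%:~R = (1 - c%:~R * m%:R) / (val p)%:R ^+ k :> rat.
    by rewrite -[X in X - _]cd addrAC subrr add0r mulfK // expf_neq0.
  by rewrite {1}xE; field; rewrite m0 expf_neq0.
rewrite padic_normM padic_normV [m%:R]pmulrn (@padic_norm_coprime p m%:Z) // divr1.
exact: padic_norm_le1.
Qed.

(** The witness is a term of a Cauchy sequence for [x], taken from where the terms differ by less
    than 1. *)
Lemma Qp_dense p (x : Qp p) : exists r : rat, Qp_norm (x - Qp_of_rat p r) <= 1.
Proof.
have /padic_cauchyP/(_ 1 ltr01)[N uN] := valP (repr x).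
exists (val (repr x) N); rewrite -{1}[x]reprK /Qp_of_rat -(rmorphB (\pi_(Qp p))).
by apply: Qp_norm_le => //; exists N => n Nn; apply/ltW/uN.
Qed.

Lemma Qp_norm_sub p (x y : Qp p) a :
  Qp_norm x <= a -> Qp_norm y <= a -> Qp_norm (x - y) <= a.
Proof.
by move=> xa ya; apply: le_trans (Qp_normD _ _) _; rewrite Qp_normN ge_max xa.
Qed.

Lemma Qp_norm_add p (x y : Qp p) a :
  Qp_norm x <= a -> Qp_norm y <= a -> Qp_norm (x + y) <= a.
Proof. by move=> xa ya; rewrite -[y]opprK Qp_norm_sub ?Qp_normN. Qed.

(* The finitely many nonintegral places are corrected one at a time, by
   rationals which are integral at the other places. *)
Lemma adele_approx_int (x : finite_adele) :
  exists r : rat, Zhat (x - adele_of_rat r).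
Proof.
have /finite_seqP[s sE] := adelicP _ (valP x).
have {}sE p : p \notin s -> Qp_norm (val x p) <= 1.
  move=> ps; apply: contrapT => xp; move/negP: ps; apply.
  by have : [set` s] p by rewrite -sE.
elim: s x sE => [|p s IH] x xs.
  by exists 0; rewrite rmorph0 subr0 => p; exact: xs.
have [a xa] := Qp_dense (val x p).
have [b [bq abp]] := rat_localize p a.
have [|r xr] := IH (x - adele_of_rat b).
  (* At [p] both [x - a] and [a - b] are integral; at a place outside [p :: s] both [x] and [b]
     are. *)
  move=> q qs; have [->|qp] := eqVneq q p.
    have -> : val (x - adele_of_rat b) p =
      (val x p - Qp_of_rat p a) + Qp_of_rat p (a - b).
      by rewrite [in RHS]rmorphB addrA subrK.
    by apply: Qp_norm_add => //; rewrite Qp_norm_of_rat.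
  apply: Qp_norm_sub; last by rewrite Qp_norm_of_rat bq.
  by apply: xs; rewrite inE negb_or qp.
by exists (b + r); rewrite rmorphD opprD addrA.
Qed.

(* The fractional ideal q Zhat. *)
Definition qZhat (q : rat) : set finite_adele :=
  [set x | forall p, Qp_norm (val x p) <= padic_norm p q].

Lemma qZhat1 : qZhat 1 = Zhat.
Proof. by apply/seteqP; split=> x xZ p; have := xZ p; rewrite padic_norm1. Qed.

Lemma qZhatB q x y : qZhat q x -> qZhat q y -> qZhat q (x - y).
Proof. by move=> xq yq p; apply: Qp_norm_sub; [exact: xq|exact: yq]. Qed.

Lemma qZhatD q x y : qZhat q x -> qZhat q y -> qZhat q (x + y).
Proof. by move=> xq yq p; apply: Qp_norm_add; [exact: xq|exact: yq]. Qed.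

Lemma qZhat0 q : qZhat q 0.
Proof. by move=> p; rewrite [Qp_norm _]Qp_norm0 padic_norm_ge0. Qed.

Lemma qZhatN q x : qZhat q x -> qZhat q (- x).
Proof. by move=> xq; rewrite -sub0r; apply: qZhatB => //; exact: qZhat0. Qed.

Lemma qZhatM q r x y : qZhat q x -> qZhat r y -> qZhat (q * r) (x * y).
Proof.
move=> xq yr p; rewrite [Qp_norm _]Qp_normM padic_normM.
by apply: ler_pM; rewrite ?Qp_norm_ge0 ?xq ?yr.
Qed.

Lemma qZhat_rat_refl q : qZhat q (adele_of_rat q).
Proof. by move=> p; rewrite [Qp_norm _]Qp_norm_of_rat. Qed.

(** This is [rat_int_padic] for [r / q]; for q = 1 it says that Q meets Zhat in Z. *)
Lemma qZhat_rat q r : q != 0 -> qZhat q (adele_of_rat r) <-> r / q \is a Num.int.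
Proof.
move=> q0; split=> [rq|/padic_norm_dvd rq p]; last first.
  by rewrite [Qp_norm _]Qp_norm_of_rat rq.
apply: rat_int_padic => p; rewrite padic_normM padic_normV.
rewrite ler_pdivrMr ?padic_norm_gt0 // mul1r -Qp_norm_of_rat; exact: rq.
Qed.

Lemma qZhat_sub q r : r != 0 -> q / r \is a Num.int -> qZhat q `<=` qZhat r.
Proof. by move=> r0 qr x xq p; apply: le_trans (xq p) _; exact: padic_norm_dvd. Qed.

Lemma adele_of_ratVK q : q != 0 -> adele_of_rat q^-1 * adele_of_rat q = 1.
Proof. by move=> q0; rewrite -rmorphM mulVf // rmorph1. Qed.

Lemma adele_approx q (x : finite_adele) : q != 0 ->
  exists r : rat, qZhat q (x - adele_of_rat r).
Proof.
move=> q0; have [r xr] := adele_approx_int (x * adele_of_rat q^-1).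
exists (r * q); rewrite -qZhat1 in xr.
have := qZhatM xr (qZhat_rat_refl q).
by rewrite mul1r mulrBl -mulrA adele_of_ratVK // mulr1 -(rmorphM adele_of_rat).
Qed.

Lemma adele_bounded (x : finite_adele) : exists2 N : nat, (0 < N)%N & qZhat N%:R^-1 x.
Proof.
have [r xr] := adele_approx_int x.
(* The denominator of a rational approximation modulo Zhat bounds all denominators of [x]. *)
exists `|denq r|%N; first by rewrite absz_gt0 denq_neq0.
have d0 : `|denq r|%:R^-1 != 0 :> rat by rewrite invr_eq0 pnatr_eq0 absz_eq0 denq_neq0.
rewrite -(subrK (adele_of_rat r) x); apply: qZhatD.
  rewrite -qZhat1 in xr; apply: qZhat_sub xr => //.
  by rewrite invrK mul1r intr_nat.
apply/qZhat_rat => //; rewrite invrK -{1}(divq_num_den r).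
by rewrite [_%:R]pmulrn absz_denq divfK ?intr_eq0 ?denq_neq0 // intr_int.
Qed.

(** * Topology of the finite adeles *)

Lemma divr_nat_int (m n : nat) : (0 < n)%N -> (n %| m)%N ->
  m%:R / n%:R \is a @Num.int rat.
Proof.
by move=> n0 /dvdnP[k ->]; rewrite natrM mulfK ?pnatr_eq0 -?lt0n.
Qed.

Lemma qZhat_dvd (m n : nat) : (0 < n)%N -> (n %| m)%N ->
  qZhat m%:R `<=` qZhat n%:R.
Proof.
by move=> n0 nm; apply: qZhat_sub; rewrite ?pnatr_eq0 -?lt0n // divr_nat_int.
Qed.

(** Multiples have smaller norm, so a single modulus can serve finitely many places at once. *)
Lemma padic_norm_prod (p : prime_nat) (s : seq prime_nat) (k : prime_nat -> nat) :
  p \in s -> padic_norm p (\prod_(q <- s) k q)%:R <= padic_norm p (k p)%:R.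
Proof.
move=> ps; rewrite (big_rem p) //= natrM padic_normM ler_piMr ?padic_norm_ge0 //.
by rewrite [_%:R]pmulrn padic_norm_le1.
Qed.

Lemma padic_norm_small p (e : rat) : 0 < e ->
  exists2 k : nat, (0 < k)%N & padic_norm p k%:R < e.
Proof.
move=> e0; have p_pr : prime (val p) by exact: valP.
have p0 : 0 < (val p)%:R :> rat by rewrite ltr0n prime_gt0.
(* The exponent is chosen so that p^n > n > 1/e. *)
pose n := (Num.truncn e^-1).+1; exists (val p ^ n)%N; first by rewrite expn_gt0 prime_gt0.
rewrite natrX padic_norm_natX exprVn invf_plt ?posrE ?exprn_gt0 //.
apply: lt_trans (truncnS_gt _) _; rewrite -natrX ltr_nat.
by rewrite -/n ltn_expl // prime_gt1.
Qed.

Lemma Qp_nbhs p (x : Qp p) (U : set (Qp p)) : nbhs x U ->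
  exists2 k : nat, (0 < k)%N & forall y, Qp_norm (y - x) <= padic_norm p k%:R -> U y.
Proof.
move=> /nbhs_ballP[e /= e0 xU]; have [k k0 ke] := padic_norm_small p e0.
exists k => // y yx; apply: xU; rewrite ballEmdist /= /mdist /=.
by rewrite -Qp_normN opprB; exact: le_lt_trans ke.
Qed.

Lemma open_Qp_disc p (x : Qp p) (a : rat) : 0 < a ->
  open [set y | Qp_norm (y - x) <= a].
Proof.
move=> a0; rewrite openE => y /= yx; apply/nbhs_ballP; exists a => //= z.
rewrite ballEmdist /= => /ltW yz; rewrite -(subrK y z) -addrA.
by apply: Qp_norm_add => //; rewrite -Qp_normN opprB.
Qed.

(** Inside a box around [x], [N] is the product of local moduli over the finitely many places where
    the box is not Z_p; at the other places [x] is integral and stays so when an integral element is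
    added. Conversely x + N Zhat is itself a box: where [x] and 1/N are both integral, [N] has norm
    1 and the disc is Z_p. *)
Lemma nbhs_adele (x : finite_adele) (U : set finite_adele) :
  nbhs x U <->
  exists2 N : nat, (0 < N)%N & forall y, qZhat N%:R (y - x) -> U y.
Proof.
split.
  rewrite nbhsE => -[_ [[D' D'D <-] [B D'B xB] BU]].
  have [Bo /finite_seqP[s sE]] := D'D _ D'B.
  have /choice[k kP] : forall p, exists k : nat, (0 < k)%N /\
      forall y, Qp_norm (y - val x p) <= padic_norm p k%:R -> B p y.
    move=> p; have [|k k0 kB] := @Qp_nbhs p (val x p) (B p); last by exists k.
    by apply: open_nbhs_nbhs; split; [exact: Bo|exact: xB].
  exists (\prod_(p <- s) k p)%N => [|y yx].
    by rewrite prodn_gt0 // => p; have [] := kP p.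
  apply: BU; exists B => //; change (forall p, B p (val y p)) => p.
  have [ps|ps] := boolP (p \in s).
    apply: (kP p).2; apply: le_trans (padic_norm_prod k ps).
    exact: yx.
  have Bp : B p = @padic_integers p.
    apply: contrapT => Bp; move/negP: ps; apply.
    by have : [set p | B p <> @padic_integers p] p by []; rewrite sE.
  have := xB p; rewrite Bp => xp.
  rewrite -(subrK (val x p) (val y p)); apply: Qp_norm_add => //.
  by apply: le_trans (yx p) _; rewrite [_%:R]pmulrn padic_norm_le1.
move=> [N N0 NU]; rewrite nbhsE.
pose B p := [set y : Qp p | Qp_norm (y - val x p) <= padic_norm p N%:R].
have NQ0 : N%:R != 0 :> rat by rewrite pnatr_eq0 -lt0n.
exists [set y : finite_adele | forall p, B p (val y p)]; last by move=> y yB; exact: NU.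
split; last by move=> p; rewrite /B /= subrr Qp_norm0 padic_norm_ge0.
exists [set B]; last by rewrite bigcup_set1.
move=> _ ->; split=> [p|]; first by apply: open_Qp_disc; rewrite padic_norm_gt0.
apply: (@sub_finite_set _ _ ([set p | ~ padic_integers (val x p)] `|`
    [set p | ~ padic_integers (val (adele_of_rat N%:R^-1) p)])); last first.
  rewrite finite_setU; split; first exact: adelicP _ (valP x).
  exact: adelicP _ (valP (adele_of_rat N%:R^-1)).
move=> p /= Bp; apply: contrapT => /not_orP[/contrapT xp /contrapT Np]; apply: Bp.
have N1 : padic_norm p N%:R = 1.
  apply/eqP; rewrite eq_le {1}[_%:R]pmulrn padic_norm_le1 /=.
  by move: Np; rewrite /padic_integers /= Qp_norm_of_rat padic_normV invf_le1 ?padic_norm_gt0.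
apply/seteqP; rewrite /B N1; split=> y /=.
  by move=> yx; rewrite -(subrK (val x p) y); exact: Qp_norm_add.
by move=> yp; exact: Qp_norm_sub.
Qed.

Lemma nbhs_qZhat (x : finite_adele) (N : nat) : (0 < N)%N ->
  nbhs x [set y | qZhat N%:R (y - x)].
Proof. by move=> N0; apply/nbhs_adele; exists N. Qed.

Lemma qZhatC q x y : qZhat q (x - y) -> qZhat q (y - x).
Proof. by move=> /qZhatN; rewrite opprB. Qed.

Lemma qZhat_trans q y x z : qZhat q (x - y) -> qZhat q (y - z) -> qZhat q (x - z).
Proof. by move=> xy /(qZhatD xy); rewrite addrA subrK. Qed.

Lemma qZhat_all_eq0 (x : finite_adele) :
  (forall N : nat, (0 < N)%N -> qZhat N%:R x) -> x = 0.
Proof.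
move=> xN; apply: adele_eqP => p; apply/eqP; rewrite -Qp_norm_eq0 eq_le Qp_norm_ge0 andbT.
rewrite leNgt; apply/negP => /(padic_norm_small p)[k k0].
by rewrite ltNge; move/negP; apply; exact: xN.
Qed.

Lemma adele_sub_continuous :
  continuous (fun xy : finite_adele * finite_adele => xy.1 - xy.2).
Proof.
move=> [x y] U /nbhs_adele[N N0 NU]; exists ([set z | qZhat N%:R (z - x)],
  [set z | qZhat N%:R (z - y)]); first by split; exact: nbhs_qZhat.
move=> [z t] /= [zx ty]; apply: NU; rewrite opprD addrACA -opprD.
exact: qZhatB.
Qed.

Lemma adele_mul_continuous (a : finite_adele) : continuous ( *%R a).
Proof.
move=> x U /nbhs_adele[N N0 NU]; have [M M0 aM] := adele_bounded a.
(* As [a] lies in M^-1 Zhat, multiplication by [a] carries M N Zhat into N Zhat. *)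
apply/nbhs_adele; exists (M * N)%N; first by rewrite muln_gt0 M0.
move=> y yx; apply: NU; rewrite -mulrBr.
have := qZhatM aM yx; rewrite natrM mulKf // pnatr_eq0 -lt0n //.
Qed.

Lemma adele_hausdorff : hausdorff_space finite_adele.
Proof.
move=> x y xy; apply/eqP; rewrite eq_sym -subr_eq0; apply/eqP/qZhat_all_eq0 => N N0.
have [z [zx zy]] := xy _ _ (nbhs_qZhat x N0) (nbhs_qZhat y N0).
by apply: qZhat_trans zx; exact: qZhatC.
Qed.

(** * Completeness and compactness *)

Lemma qZhat_fact_le (m n : nat) : (n <= m)%N -> qZhat m`!%:R `<=` qZhat n`!%:R.
Proof.
move=> nm; apply: qZhat_dvd; first exact: fact_gt0.
by rewrite -(ffact_fact (leq_subr n m)) subKn // dvdn_mull.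
Qed.

(** Every positive N divides n! for n >= N, so [r] is Cauchy for all p at once and the same rational
    sequence represents every component of the limit. The limit is an adele because it differs from
    [r 0] by an element of Zhat. *)
Lemma adele_cvg (r : nat -> rat) :
  (forall n, qZhat n`!%:R (adele_of_rat (r n.+1 - r n))) ->
  exists x, forall n, qZhat n`!%:R (x - adele_of_rat (r n)).
Proof.
move=> rS; have rD m n : (n <= m)%N -> qZhat n`!%:R (adele_of_rat (r m - r n)).
  elim: m => [|m IH]; first by rewrite leqn0 => /eqP ->; rewrite subrr rmorph0; exact: qZhat0.
  rewrite leq_eqVlt => /orP[/eqP ->|]; first by rewrite subrr rmorph0; exact: qZhat0.
  rewrite ltnS => nm; rewrite rmorphB; apply: (@qZhat_trans _ (adele_of_rat (r m))).
    by rewrite -rmorphB; apply: qZhat_fact_le nm _ (rS m).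
  by rewrite -rmorphB; exact: IH.
have rp p m n : (n <= m)%N -> padic_norm p (r m - r n) <= padic_norm p n`!%:R.
  by move=> /rD/(_ p); rewrite [Qp_norm _]Qp_norm_of_rat.
have rC p : r \in padic_cauchy p.
  apply/padic_cauchyP => e /(padic_norm_small p)[N N0 Ne]; exists N.
  have NN k : (N <= k)%N -> padic_norm p (r k - r N) < e.
    move=> /rp Nk; apply: le_lt_trans Ne; apply: le_trans (Nk p) _.
    apply: padic_norm_dvd; first by rewrite pnatr_eq0 -lt0n.
    by rewrite divr_nat_int // dvdn_fact // N0 /=.
  move=> m n Nm Nn; apply: (@padic_norm_dist _ _ (r N)); first exact: NN.
  by rewrite padic_normB NN.
pose x : Qp_prod := fun p => \pi_(Qp p) (Sub r (rC p) : cauchy_seq p).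
have xr n p : Qp_norm (x p - Qp_of_rat p (r n)) <= padic_norm p n`!%:R.
  rewrite /x /Qp_of_rat -(rmorphB (\pi_(Qp p))); apply: Qp_norm_le.
    by rewrite padic_norm_gt0 pnatr_eq0 -lt0n fact_gt0.
  by exists n => m nm; exact: rp.
have xA : x \in adelic.
  have -> : x = (x - val (adele_of_rat (r 0%N))) + val (adele_of_rat (r 0%N)).
    by rewrite subrK.
  rewrite rpredD ?(valP (adele_of_rat _))//; apply/adelicP.
  rewrite (_ : [set _ | _] = set0); first exact: finite_set0.
  apply/seteqP; split=> // p /=; apply.
  by have := xr 0%N p; rewrite fact0 padic_norm1.
by exists (Sub x xA) => n p; exact: xr.
Qed.

(** A rational approximation of [x] modulo N Zhat lies in Zhat, hence is an integer, and can be
    reduced modulo [N]. *)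
Lemma Zhat_mod (N : nat) (x : finite_adele) : (0 < N)%N -> Zhat x ->
  exists i : 'I_N, qZhat N%:R (x - adele_of_rat (i : nat)%:R).
Proof.
move=> N0 xZ; have NQ0 : N%:R != 0 :> rat by rewrite pnatr_eq0 -lt0n.
have [r xr] := adele_approx x NQ0.
have /intrP[k kr] : r \is a Num.int.
  rewrite -[r]divr1; apply/qZhat_rat => //.
  rewrite -(subKr x (adele_of_rat r)); apply: qZhatB; first by rewrite qZhat1.
  by rewrite -[1]/(1%:R); apply: qZhat_dvd xr.
have NZ0 : Posz N != 0 by rewrite eqz_nat -lt0n.
have kN0 : 0 <= (k %% N)%Z by rewrite modz_ge0.
have iN : (`|(k %% N)%Z|%N < N)%N by rewrite -ltz_nat gez0_abs // ltz_pmod.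
exists (Ordinal iN) => /=; apply: qZhat_trans xr _.
rewrite -rmorphB; apply/qZhat_rat => //.
have -> : `|(k %% N)%Z|%:R = (k %% N)%Z%:~R :> rat by rewrite pmulrn gez0_abs.
rewrite kr {1}(divz_eq k N) rmorphD rmorphM /= addrK.
by rewrite -pmulrn mulfK // intr_int.
Qed.

(** For each n, an ultrafilter containing Zhat contains one of the n! cosets of n! Zhat. Chosen
    cosets for n and n + 1 intersect, so their representatives are coherent and converge to a limit
    of the ultrafilter. *)
Lemma Zhat_compact : compact Zhat.
Proof.
rewrite compact_ultra => F FU FZ.
have /choice[r rF] : forall n, exists r, F [set x | qZhat n`!%:R (x - adele_of_rat r)].
  move=> n; apply: contrapT => /forallNP nr.
  have : F [set x | forall i : 'I_n`!, ~ qZhat n`!%:R (x - adele_of_rat (i : nat)%:R)].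
    apply: filter_forall => i.
    by have [/nr|] := in_ultra_setVsetC
      [set x | qZhat n`!%:R (x - adele_of_rat (i : nat)%:R)] FU.
  move=> /(filterI FZ)/filter_ex[x [xZ xi]].
  by have [i /xi] := Zhat_mod (fact_gt0 n) xZ.
have [|x xr] := @adele_cvg r.
  move=> n; have [y [yn yS]] := filter_ex (filterI (rF n) (rF n.+1)).
  rewrite rmorphB; apply: qZhat_trans yn; apply: qZhatC.
  exact: qZhat_fact_le yS.
exists x; split.
  have [y [yZ yr]] := filter_ex (filterI FZ (rF 0%N)).
  rewrite -qZhat1 in yZ *; rewrite -(subrK y x); apply: qZhatD => //.
  by apply: qZhat_trans (xr 0%N) (qZhatC yr).
move=> U /nbhs_adele[N N0 NU]; apply: filterS (rF N) => y yr; apply: NU.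
apply: (@qZhat_dvd N`! N) => //; first by rewrite dvdn_fact // N0 /=.
exact: qZhat_trans yr (qZhatC (xr N)).
Qed.

Lemma qZhat_compact q : q != 0 -> compact (qZhat q).
Proof.
move=> q0; rewrite (_ : qZhat q = *%R (adele_of_rat q) @` Zhat).
  apply: continuous_compact Zhat_compact; apply: continuous_subspaceT.
  exact: adele_mul_continuous.
rewrite -qZhat1; apply/seteqP; split=> [x xq|_ [x x1 <-]]; last first.
  by have := qZhatM (qZhat_rat_refl q) x1; rewrite mulr1.
exists (adele_of_rat q^-1 * x); last by rewrite mulrA -rmorphM divff // rmorph1 mul1r.
by have := qZhatM (qZhat_rat_refl q^-1) xq; rewrite mulVf.
Qed.

Lemma adele_lca : locally_compact_abelian_group finite_adele.
Proof.
split; [exact: adele_sub_continuous|exact: adele_hausdorff|].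
move=> x _; pose T := (fun y : finite_adele => y - x) @^-1` Zhat.
have TE : T = (fun y => x + y) @` Zhat.
  apply/seteqP; split=> [y yZ|_ [y yZ <-]]; last by rewrite /T /= addrAC subrr add0r.
  by exists (y - x) => //; rewrite addrC subrK.
have Tc : compact T.
  rewrite TE; apply: continuous_compact Zhat_compact; apply: continuous_subspaceT.
  move=> y U /nbhs_adele[N N0 NU]; apply/nbhs_adele; exists N => // z zy.
  by apply: NU; rewrite opprD addrACA subrr add0r.
exists T; last by split => //; exact: compact_closed adele_hausdorff Tc.
apply: filterS (nbhs_qZhat x (ltn0Sn 0)) => y /= + _.
by rewrite /T /= -qZhat1.
Qed.

(** * The circle *)

Section Circle.
Variable R : realType.
Implicit Types (z w : circle R) (t : R) (r s : rat).

Lemma val_circleX z n : val (z ^+ n)%g = val z ^+ n.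
Proof. by elim: n => [|n IH]; rewrite ?expg0 ?expr0 // expgS exprS -IH. Qed.

Lemma expiD t u : expi (t + u) = (expi t * expi u)%g.
Proof.
apply: val_inj; apply/eqP; rewrite eq_complex /= cosD sinD eqxx /=.
by rewrite addrC eqxx.
Qed.

Lemma expi0 : expi 0 = 1%g :> circle R.
Proof. by apply: val_inj; apply/eqP; rewrite eq_complex /= cos0 sin0 !eqxx. Qed.

Lemma expi2pi : expi (2 * pi) = 1%g :> circle R.
Proof.
apply: val_inj; apply/eqP; rewrite eq_complex /= mulr_natl cos2pi sin2pi.
by rewrite !eqxx.
Qed.

(** By [cis_int], [cis_eq1] and [cis_root], this identifies Q/Z with the group of roots of unity. *)
Definition cis r : circle R := expi (2 * pi * ratr r).

Lemma cisD r s : cis (r + s) = (cis r * cis s)%g.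
Proof. by rewrite /cis rmorphD mulrDr expiD. Qed.

Lemma cis0 : cis 0 = 1%g.
Proof. by rewrite /cis rmorph0 mulr0 expi0. Qed.

Lemma cisMn r n : cis (n%:R * r) = (cis r ^+ n)%g.
Proof.
elim: n => [|n IH]; first by rewrite mul0r cis0.
by rewrite expgS -IH -natr1 mulrDl mul1r addrC cisD.
Qed.

Lemma cis_int r : r \is a Num.int -> cis r = 1%g.
Proof.
have cis_nat n : cis n%:R = 1%g.
  by rewrite -[n%:R]mulr1 cisMn /cis rmorph1 mulr1 expi2pi expg1n.
move=> /intrP[[n|n] ->]; first by rewrite -pmulrn cis_nat.
have := cisD (- n.+1%:R) n.+1%:R.
by rewrite addNr cis0 cis_nat mulg1 => <-.
Qed.

(** For the fractional part s of [r], 1 = cos (2 pi s) = 2 cos^2 (pi s) - 1 forces sin (pi s) = 0,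
    which is impossible for 0 < s < 1. *)
Lemma cis_eq1 r : cis r = 1%g -> r \is a Num.int.
Proof.
pose s := r - (Num.floor r)%:~R.
have /andP[s0 s1] : 0 <= s < 1.
  by have := floor_itv r; rewrite intrD subr_ge0 ltrBlDl.
have -> : r = s + (Num.floor r)%:~R by rewrite subrK.
rewrite cisD (@cis_int _%:~R) ?intr_int // mulg1 rpredDr ?intr_int // => s_eq.
suff -> : s = 0 by [].
apply/eqP; apply: contraT => sN0.
have {}s0 : 0 < s by rewrite lt0r sN0.
have := congr1 (fun z => complex.Re (val z)) s_eq => /=.
rewrite -mulrA mulr_natl cos_mulr2n => c1.
have : 0 < sin (pi * ratr s : R).
  rewrite sin_gt0_pi // mulr_gt0 ?pi_gt0 ?ltr0q // gtr_pMr ?pi_gt0 //.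
  by rewrite /= -[1](rmorph1 (@ratr R)) ltr_rat.
have := cos2Dsin2 (pi * ratr s : R); nra.
Qed.

(* The n-th roots of unity are the powers of the primitive root cis (1/n). *)
Lemma cis_root z n : (0 < n)%N -> (z ^+ n = 1)%g ->
  exists k : nat, z = cis (k%:R / n%:R).
Proof.
move=> n0 zn; have nQ0 : n%:R != 0 :> rat by rewrite pnatr_eq0 -lt0n.
pose w := cis n%:R^-1.
have wX k : val w ^+ k = val (cis (k%:R / n%:R)) by rewrite cisMn val_circleX.
have w_prim : n.-primitive_root (val w).
  rewrite /primitive_root_of_unity n0; apply/forallP => i.
  rewrite unity_rootE wX -[1]/(val (1%g : circle R)) (inj_eq val_inj).
  apply/eqP; apply/eqP/eqP => [/cis_eq1|->]; last first.
    by rewrite divff // cis_int // rpred1.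
  (* Here (i + 1)/n is a positive integer, hence at least 1, and i + 1 <= n. *)
  move=> /intrP[k kE]; have kn : i.+1%:R = k%:~R * n%:R :> rat by rewrite -kE divfK.
  have k_gt0 : 0 < k.
    by rewrite -(ltr0z rat) -kE divr_gt0 ?ltr0n.
  apply/eqP; rewrite eqn_leq ltn_ord /= -(ler_nat rat) kn ler_peMl //.
  by rewrite -[1]/(1%:~R) ler_int -gtz0_ge1.
have [|i zE] := prim_rootP w_prim (x := val z); first by rewrite -val_circleX zn.
by exists i; apply: val_inj; rewrite -wX.
Qed.

(** A neighbourhood of 1 containing no nontrivial subgroup; its radius keeps |1 + w| above a
    constant larger than 1. *)
Definition near1 : set (circle R) := val @^-1` ball (1 : R[i]^o) 2^-1.

Lemma open_near1 : open near1.
Proof. by exists (ball (1 : R[i]^o) 2^-1) => //; exact: ball_open. Qed.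

Lemma near1_1 : near1 1%g.
Proof. by apply: ballxx; rewrite invr_gt0. Qed.

(* Squaring a point of near1 multiplies its distance to 1 by at least 3/2. *)
Lemma near1_trivial z : (forall n, near1 (z ^+ n)%g) -> z = 1%g.
Proof.
move=> z1; pose d n := `|1 - val z ^+ (2 ^ n) : R[i]^o|.
have d_lt n : d n < 2^-1 by have := z1 (2 ^ n)%N; rewrite /near1 /ball /= val_circleX.
have dS n : 3 / 2 * d n <= d n.+1.
  rewrite /d expnSr exprM; set w := val z ^+ (2 ^ n).
  have -> : 1 - w ^+ 2 = (1 + w) * (1 - w) by ring.
  rewrite normrM ler_wpM2r ?normr_ge0 //.
  have -> : 1 + w = 2 - (1 - w) by ring.
  apply: le_trans (lerB_dist _ _); rewrite normr_nat lerBrDr.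
  have two : 3 / 2 + 2^-1 = 2 :> R[i] by field.
  by rewrite -[leRHS]two lerD2l; exact: ltW (d_lt n).
have dX n : (3 / 2) ^+ n * d 0%N <= d n.
  elim: n => [|n IH]; first by rewrite mul1r.
  by rewrite exprS -mulrA; apply: le_trans (dS n); rewrite ler_wpM2l.
(* Norms take values in [R[i]]; the real part moves the estimate to [R], which is archimedean. *)
pose c := complex.Re (d 0%N).
have d0E : d 0%N = c%:C%C by rewrite /c /d normc_def.
have c_ge0 : 0 <= c by rewrite -lecR -d0E normr_ge0.
have half : 2^-1 = (2^-1 : R)%:C%C.
  by have := fmorphV (real_complex R) 2; rewrite rmorph_nat.
have cX n : (3 / 2) ^+ n * c < 2^-1.
  have := le_lt_trans (dX n) (d_lt n); rewrite d0E half.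
  have -> : 3 = (3 : R)%:C%C by rewrite -(rmorph_nat (real_complex R)).
  rewrite -(rmorphM (real_complex R)) -(rmorphXn (real_complex R)).
  by rewrite -(rmorphM (real_complex R)) ltcR.
have bernoulli n : n%:R / 2 <= (3 / 2) ^+ n :> R.
  elim: n => [|n IH]; first by rewrite mul0r.
  have : 1 <= (3 / 2) ^+ n :> R by rewrite exprn_ege1 //; lra.
  by rewrite exprS -[n.+1%:R]natr1; lra.
have c0 : c = 0.
  apply/eqP; apply: contraT => cN0; have c_gt0 : 0 < c by rewrite lt0r cN0.
  (* With n > 1/c, the bound (3/2)^n c >= n c / 2 > 1/2 contradicts [cX]. *)
  have nc := truncnS_gt c^-1; set n := _.+1 in nc.
  have : 1 < n%:R * c by rewrite -ltr_pdivrMr // div1r.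
  have := cX n; have := bernoulli n; rewrite -(ler_pM2r c_gt0); lra.
apply: val_inj; apply/eqP; rewrite eq_sym -subr_eq0 -normr_eq0.
by have := d0E; rewrite c0 /d expr1 => ->.
Qed.

End Circle.

(** * Characters *)

Lemma frac_partP (x : finite_adele) : Zhat (x - adele_of_rat (frac_part x)).
Proof.
rewrite /frac_part; case: xgetP => [r _ [] //|/=].
(* A rational approximation minus its floor meets the condition, so the default value of [xget] does
   not occur. *)
have [r xr] := adele_approx_int x; pose s := r - (Num.floor r)%:~R.
move=> /(_ s)[]; split.
  by have := floor_itv r; rewrite intrD subr_ge0 ltrBlDl.
rewrite -qZhat1 in xr *; rewrite rmorphB opprB addrCA addrC; apply: qZhatD => //.
by apply/qZhat_rat => //; rewrite divr1 intr_int.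
Qed.

(** Multiply by N! to enter Zhat, reduce modulo N!, divide back. Thus a character trivial on Zhat is
    determined by its values at the 1/n!. *)
Lemma adele_fact_approx (x : finite_adele) :
  exists n i : nat, Zhat (x - adele_of_rat (i%:R / n`!%:R)).
Proof.
have [N N0 xN] := adele_bounded x; exists N.
have F0 : N`!%:R != 0 :> rat by rewrite pnatr_eq0 -lt0n fact_gt0.
have Fx : Zhat (adele_of_rat N`!%:R * x).
  rewrite -qZhat1; have := qZhatM (qZhat_rat_refl N`!%:R) xN; apply: qZhat_sub => //.
  by rewrite divr1 divr_nat_int // dvdn_fact // N0 /=.
have [i xi] := Zhat_mod (fact_gt0 N) Fx; exists i; rewrite -qZhat1.
have := qZhatM (qZhat_rat_refl N`!%:R^-1) xi.
by rewrite mulVf // mulrBr mulrA -!rmorphM mulVf // rmorph1 mul1r mulrC.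
Qed.

Lemma adele_of_ratMn (r : rat) n : adele_of_rat r *+ n = adele_of_rat (n%:R * r).
Proof. by rewrite mulr_natl raddfMn. Qed.

Section Characters.
Variable R : realType.

Section Morphism.
Variables (G : zmodType) (f : G -> circle R).
Hypothesis fD : forall x y, f (x + y) = (f x * f y)%g.

Lemma char_morph0 : f 0 = 1%g.
Proof. by apply: (mulgI (f 0)); rewrite -fD addr0 mulg1. Qed.

Lemma char_morphB x y : f (x - y) = (f x * (f y)^-1)%g.
Proof. by apply: (mulIg (f y)); rewrite -fD subrK -mulgA mulVg mulg1. Qed.

Lemma char_morphMn x n : f (x *+ n) = (f x ^+ n)%g.
Proof.
by elim: n => [|n IH]; rewrite ?mulr0n ?char_morph0 // mulrS fD IH expgS.
Qed.

End Morphism.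

(** The powers of [f x] are the values of [f] at the multiples of [x], so they all stay in
    [near1]. *)
Lemma subgroup_near1_trivial (G : zmodType) (f : G -> circle R) (A : set G) :
  (forall x y, f (x + y) = (f x * f y)%g) ->
  (forall x n, A x -> A (x *+ n)) -> (forall x, A x -> @near1 R (f x)) ->
  forall x, A x -> f x = 1%g.
Proof.
move=> fD An Af x Ax; apply: near1_trivial => n.
by rewrite -char_morphMn //; apply/Af/An.
Qed.

Lemma qZhatMn q x n : qZhat q x -> qZhat q (x *+ n).
Proof.
by move=> xq; elim: n => [|n IH]; [exact: qZhat0|rewrite mulrS; exact: qZhatD].
Qed.

(** Continuity at 0 puts the image of some N Zhat inside [near1], and this image is a subgroup. *)
Lemma char_trivial_near0 (f : finite_adele -> circle R) : is_character f ->
  exists2 N : nat, (0 < N)%N & forall x, qZhat N%:R x -> f x = 1%g.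
Proof.
move=> [fC fD].
have f0 : nbhs (f 0) (@near1 R).
  rewrite (char_morph0 fD).
  by apply: open_nbhs_nbhs; split; [exact: open_near1|exact: near1_1].
have := fC 0 _ f0; rewrite nbhs_filterE => /nbhs_adele[N N0 NU]; exists N => //.
apply: subgroup_near1_trivial => // [x n|x xN]; first exact: qZhatMn.
by apply: NU; rewrite subr0.
Qed.

(** * The canonical character and the characters it generates *)

(** Two rationals congruent to [x] modulo Zhat differ by an integer. This makes [chi] additive
    although [frac_part] is not. *)
Lemma chiE (x : finite_adele) (r : rat) :
  Zhat (x - adele_of_rat r) -> chi R x = cis R r.
Proof.
move=> xr; rewrite -[r](subrK (frac_part x)) addrC cisD [X in (_ * X)%g]cis_int ?mulg1 //.
rewrite -[_ - _]divr1; apply/qZhat_rat => //; rewrite rmorphB.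
rewrite -qZhat1 in xr; apply: qZhat_trans (qZhatC xr) _.
by rewrite qZhat1; exact: frac_partP.
Qed.

Lemma chi_eq1 x : chi R x = 1%g <-> Zhat x.
Proof.
split=> [/cis_eq1 xI|xZ]; last by rewrite (@chiE x 0) ?cis0 // rmorph0 subr0.
rewrite -qZhat1 -(subrK (adele_of_rat (frac_part x)) x); apply: qZhatD.
  by rewrite qZhat1; exact: frac_partP.
by apply/qZhat_rat => //; rewrite divr1.
Qed.

Lemma chiD x y : chi R (x + y) = (chi R x * chi R y)%g.
Proof.
rewrite (chiE (frac_partP x)) (chiE (frac_partP y)) -cisD; apply: chiE.
rewrite -qZhat1 rmorphD opprD addrACA.
by apply: qZhatD; rewrite qZhat1; exact: frac_partP.
Qed.

Lemma chi_continuous : continuous (chi R).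
Proof.
move=> x U /nbhs_singleton Ux; apply: filterS (nbhs_qZhat x (ltn0Sn 0)) => y /= yx.
have -> : y = x + (y - x) by rewrite addrC subrK.
by rewrite chiD (_ : chi R (y - x) = 1%g) ?mulg1 //; apply/chi_eq1; rewrite -qZhat1.
Qed.

Lemma chi_mul_char (xi : finite_adele) :
  is_character (fun x : finite_adele => chi R (xi * x)).
Proof.
split=> [x|x y]; last by rewrite mulrDr chiD.
apply: (@continuous_comp _ _ _ ( *%R xi) (chi R)); first exact: adele_mul_continuous.
exact: chi_continuous.
Qed.

(* A character f that is trivial on Zhat factors through Q/Z, and is determined
   by the roots of unity f (1/n!) = cis (k_n / n!). The integers k_n are
   coherent modulo n!, so they converge in Zhat. *)
Lemma char_Zhat_trivial (f : finite_adele -> circle R) :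
  (forall x y, f (x + y) = (f x * f y)%g) -> (forall x, Zhat x -> f x = 1%g) ->
  exists xi, forall x, f x = chi R (xi * x).
Proof.
move=> fD fZ; have F0 n : n`!%:R != 0 :> rat by rewrite pnatr_eq0 -lt0n fact_gt0.
have /choice[k kE] : forall n, exists k : nat,
    f (adele_of_rat n`!%:R^-1) = cis R (k%:R / n`!%:R).
  (* The n!-th power of f (1/n!) is f 1, and 1 lies in Zhat. *)
  move=> n; apply: cis_root; rewrite ?fact_gt0 //.
  rewrite -char_morphMn // adele_of_ratMn.
  rewrite divff // rmorph1 fZ // => p.
  exact: padic_integers1.
have [|xi xiE] := @adele_cvg (fun n => (k n)%:R).
  (* Since 1/n! = (n + 1) / (n + 1)!, both k_(n+1) / n! and k_n / n! have [cis] value f (1/n!), so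
     they differ by an integer. *)
  move=> n; apply/qZhat_rat => //; apply: (@cis_eq1 R); rewrite mulrBl.
  have -> : (k n.+1)%:R / n`!%:R = n.+1%:R * ((k n.+1)%:R / n.+1`!%:R) :> rat.
    rewrite factS natrM; field; rewrite F0 /=.
    by rewrite -[1 + _](natrD _ 1 n) pnatr_eq0.
  rewrite (char_morphB (cisD R)) cisMn -!kE -char_morphMn // adele_of_ratMn.
  have -> : n.+1%:R * n.+1`!%:R^-1 = n`!%:R^-1 :> rat.
    rewrite factS natrM; field; rewrite F0 /=.
    by rewrite -[1 + _](natrD _ 1 n) pnatr_eq0.
  by rewrite mulgV.
have xi1 : qZhat 1 xi.
  rewrite -(subrK (adele_of_rat (k 0%N)%:R) xi); apply: qZhatD (xiE 0%N) _.
  by apply/qZhat_rat => //; rewrite divr1 rpred_nat.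
exists xi => x; have [n [i xn]] := adele_fact_approx x.
(* Modulo Zhat, [xi * x] is xi i/n! because [xi] and x - i/n! lie in Zhat, and this is k_n i/n!
   because xi - k_n lies in n! Zhat. *)
rewrite (@chiE _ (i%:R * ((k n)%:R / n`!%:R))); last first.
  rewrite -qZhat1; apply: (@qZhat_trans _ (xi * adele_of_rat (i%:R / n`!%:R))).
    by rewrite -mulrBr -[1]mulr1; apply: qZhatM => //; rewrite qZhat1.
  have -> : i%:R * ((k n)%:R / n`!%:R) = (k n)%:R * (i%:R / n`!%:R) :> rat by ring.
  rewrite (rmorphM adele_of_rat (k n)%:R) -mulrBl.
  have := qZhatM (xiE n) (qZhat_rat_refl (i%:R / n`!%:R)).
  apply: qZhat_sub => //.
  by rewrite divr1 mulrC divfK // rpred_nat.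
rewrite -[x](subrK (adele_of_rat (i%:R / n`!%:R))) fD (fZ _ xn) mul1g.
by rewrite cisMn -kE -char_morphMn // adele_of_ratMn.
Qed.

Lemma char_adele (f : finite_adele -> circle R) : is_character f ->
  exists xi, forall x, f x = chi R (xi * x).
Proof.
move=> fch; have [N N0 fN] := char_trivial_near0 fch; have [_ fD] := fch.
have NQ0 : N%:R != 0 :> rat by rewrite pnatr_eq0 -lt0n.
have [||xi xiE] := @char_Zhat_trivial (fun x => f (adele_of_rat N%:R * x)).
- by move=> x y; rewrite mulrDr fD.
- move=> x xZ; apply: fN; rewrite -qZhat1 in xZ.
  by have := qZhatM (qZhat_rat_refl N%:R) xZ; rewrite mulr1.
exists (xi * adele_of_rat N%:R^-1) => x; rewrite -mulrA -xiE mulrA -rmorphM.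
by rewrite divff // rmorph1 mul1r.
Qed.

(** Evaluation at 1/N puts xi / N in Zhat, so [xi] lies in every N Zhat. *)
Lemma chi_mul_inj (xi : finite_adele) : (forall x, chi R (xi * x) = 1%g) -> xi = 0.
Proof.
move=> xi1; apply: qZhat_all_eq0 => N N0.
have NQ0 : N%:R != 0 :> rat by rewrite pnatr_eq0 -lt0n.
have /chi_eq1 := xi1 (adele_of_rat N%:R^-1); rewrite -qZhat1 => xiN.
have := qZhatM xiN (qZhat_rat_refl N%:R).
by rewrite mul1r -mulrA adele_of_ratVK // mulr1.
Qed.

(** * Continuity in both directions *)

(** The sets n!^-1 Zhat increase with n, and each adele has a whole neighbourhood in one of them. *)
Lemma compact_adele_bounded (K : set finite_adele) : compact K ->
  exists2 N : nat, (0 < N)%N & K `<=` qZhat N%:R^-1.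
Proof.
have F0 n : n`!%:R != 0 :> rat by rewrite pnatr_eq0 -lt0n fact_gt0.
move=> /compact_near_coveringP/(_ nat \oo (fun n => qZhat n`!%:R^-1))[x _|N _ KN].
  have [N N0 xN] := adele_bounded x.
  exists (qZhat 1 \o (fun y => y - x), [set n | (N <= n)%N]).
    by split; [exact: (nbhs_qZhat x (ltn0Sn 0))|exists N].
  move=> [y n] /= [yx Nn]; rewrite -(subrK x y); apply: qZhatD.
    by apply: qZhat_sub yx; rewrite ?invr_eq0 // invrK mul1r rpred_nat.
  apply: qZhat_sub xN; rewrite ?invr_eq0 // invrK mulrC divr_nat_int //.
  by rewrite dvdn_fact // N0.
by exists N`!; [exact: fact_gt0|exact: KN (leqnn N)].
Qed.

Definition chi_char (xi : finite_adele) : Char R finite_adele :=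
  SigSub (mem_set (chi_mul_char xi :
    [set f : {compact-open, finite_adele -> circle R} | is_character f]
      (fun x => chi R (xi * x)))).

Lemma chi_char_continuous : continuous chi_char.
Proof.
apply: continuous_comp_initial => xi.
apply/compact_open_cvgP; first by apply: fmap_filter; exact: nbhs_filter.
move=> K O Kc Oo KO; have {}KO y : K y -> O (chi R (xi * y)).
  by move=> Ky; apply: (KO (chi R (xi * y))); exists y.
have [N N0 KN] := compact_adele_bounded Kc.
have NQ0 : N%:R != 0 :> rat by rewrite pnatr_eq0 -lt0n.
(* The product of N Zhat with N^-1 Zhat lies in the kernel of [chi], so the two characters are equal
   on [K], not merely close. *)
apply: filterS (nbhs_qZhat xi N0) => xi' xixi' _ [x Kx <-].
suff xi'x : chi R (xi' * x) = chi R (xi * x).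
  by change (O (chi R (xi' * x))); rewrite xi'x; exact: KO.
rewrite -(subrK xi xi') mulrDl chiD (_ : chi R _ = 1%g) ?mul1g //.
apply/chi_eq1; rewrite -qZhat1.
by have := qZhatM xixi' (KN _ Kx); rewrite divff.
Qed.

Lemma circle_mulr_continuous (c : circle R) : continuous (fun z : circle R => (z * c)%g).
Proof.
move=> z; apply: (@continuous_comp _ _ _ (fun w : circle R => (w, c))
  (fun zw : circle R * circle R => (zw.1 * zw.2)%g)).
  have idC : {for z, continuous (fun w : circle R => w)} by exact: cvg_id.
  have cstC : {for z, continuous (fun _ : circle R => c)} by exact: cst_continuous.
  exact: (cvg_pair idC cstC).
exact: circle_mul_continuous.
Qed.

Lemma nbhs_char (f : Char R finite_adele) (K : set finite_adele) (O : set (circle R)) :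
  compact K -> open O -> (forall x, K x -> O (char_fun f x)) ->
  \forall g \near f, forall x, K x -> O (char_fun g x).
Proof.
move=> Kc Oo KO; apply: (@filterS _ _ _ (val @^-1` [set g | g @` K `<=` O])).
  by move=> g /= gKO x Kx; apply: gKO; exists x.
apply: (@initial_continuous _ _
  (val : Char R finite_adele -> {compact-open, finite_adele -> circle R})).
apply: open_nbhs_nbhs; split; first exact: compact_open_open.
by move=> _ [x Kx <-]; exact: KO.
Qed.

(* K = M^-1 Zhat is a finite union of cosets of N Zhat, where N Zhat is in the
   kernel of f; on each of them g is asked to be close to the constant f. *)
Lemma nbhs_char_eq (f : Char R finite_adele) (M : nat) : (0 < M)%N ->
  \forall g \near f, forall x, qZhat M%:R^-1 x -> char_fun g x = char_fun f x.
Proof.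
move=> M0; have [N N0 fN] := char_trivial_near0 (char_funP f).
have MQ0 : M%:R != 0 :> rat by rewrite pnatr_eq0 -lt0n.
have NQ0 : N%:R != 0 :> rat by rewrite pnatr_eq0 -lt0n.
have [_ fD] := char_funP f.
(* The fractions i/M with i < M N represent all cosets of N Zhat in M^-1 Zhat. *)
pose a (i : 'I_(M * N)) := adele_of_rat ((i : nat)%:R / M%:R).
pose K i := (fun x => x - a i) @^-1` qZhat N%:R.
pose O i := (fun z => (z * (char_fun f (a i))^-1)%g) @^-1` @near1 R.
have fK i x : K i x -> char_fun f x = char_fun f (a i).
  by move=> Kx; rewrite -[x](subrK (a i)) fD (fN _ Kx) mul1g.
have Kc i : compact (K i).
  rewrite (_ : K i = (fun x => x + a i) @` qZhat N%:R).
    apply: continuous_compact (qZhat_compact NQ0); apply: continuous_subspaceT.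
    move=> y U /nbhs_adele[L L0 LU]; apply/nbhs_adele; exists L => // z zy.
    by apply: LU; rewrite opprD addrACA subrr addr0.
  apply/seteqP; split=> [y yK|_ [y yZ <-]]; last by rewrite /K /= addrK.
  by exists (y - a i) => //; rewrite subrK.
have Oo i : open (O i).
  apply: open_comp; last exact: open_near1.
  by move=> z _; exact: circle_mulr_continuous.
have near_f : \forall g \near f, forall i x, K i x -> O i (char_fun g x).
  apply: (@filter_forall _ _
    (fun i g => forall x, K i x -> O i (char_fun g x)) _ (nbhs_filter f)) => i.
  by apply: nbhs_char => // x /fK ->; rewrite /O /= mulgV; exact: near1_1.
(* The quotient [h] of [g] by [f] maps the group M^-1 Zhat into [near1], so it is trivial there. *)
apply: filterS near_f => g gO; pose h := char_fun (g - f).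
have hE x : h x = (char_fun g x * (char_fun f x)^-1)%g by [].
have [_ hD] := char_funP (g - f).
suff h1 x : qZhat M%:R^-1 x -> h x = 1%g.
  move=> x /h1 hx; apply: (mulIg (char_fun f x)^-1%g).
  by rewrite -hE hx mulgV.
apply: subgroup_near1_trivial => // [y n|y yM]; first exact: qZhatMn.
(* Reducing M y modulo M N and dividing by M finds the coset of [y]. *)
have My : Zhat (adele_of_rat M%:R * y).
  by rewrite -qZhat1; have := qZhatM (qZhat_rat_refl M%:R) yM; rewrite divff.
have [|i yi] := @Zhat_mod (M * N) _ _ My; first by rewrite muln_gt0 M0.
have Ky : K i y.
  have := qZhatM (qZhat_rat_refl M%:R^-1) yi.
  rewrite natrM mulKf // mulrBr mulrA -!rmorphM mulVf // rmorph1 mul1r.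
  by rewrite [_^-1 * _]mulrC.
by have := gO i y Ky; rewrite /O /= -(fK i y Ky) -hE.
Qed.

Lemma chi_char_iso : topological_group_iso chi_char.
Proof.
have chi_charD : {morph chi_char : x y / x + y >-> x + y}.
  by move=> x y; apply/val_inj/funext => z; rewrite /= mulrDl chiD.
split=> //; first exact: chi_char_continuous.
have /choice[g gE] : forall f : Char R finite_adele, exists xi, chi_char xi = f.
  move=> f; have [xi xiE] := char_adele (char_funP f); exists xi.
  by apply/val_inj/funext => x; rewrite /= -xiE.
have chi_eq x y : (forall z, chi R (x * z) = chi R (y * z)) -> x = y.
  move=> xy; apply/eqP; rewrite -subr_eq0; apply/eqP/chi_mul_inj => z.
  by rewrite mulrBl (char_morphB chiD) xy mulgV.
exists g; split=> // [x|f].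
  by apply: chi_eq => z; have /(congr1 (fun f => char_fun f z)) := gE (chi_char x).
(* Agreement of [h] with [f] on N^-1 Zhat is used at the single point 1/N: it puts (g h - g f) / N
   in the kernel Zhat of [chi]. *)
move=> U /nbhs_adele[N N0 NU]; apply: filterS (nbhs_char_eq f N0) => h hf.
apply: NU; have NQ0 : N%:R != 0 :> rat by rewrite pnatr_eq0 -lt0n.
have : Zhat ((g h - g f) * adele_of_rat N%:R^-1).
  apply/chi_eq1; rewrite mulrBl (char_morphB chiD).
  have := hf _ (qZhat_rat_refl N%:R^-1).
  by rewrite -{1}(gE h) -{1}(gE f) /char_fun /= => ->; rewrite mulgV.
rewrite -qZhat1 => gN; have := qZhatM gN (qZhat_rat_refl N%:R).
by rewrite mul1r -mulrA adele_of_ratVK // mulr1.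
Qed.

End Characters.

(** * Transport of structure to the dual group *)

Lemma lca_iso (G H : PreTopologicalZmodule.type) (f : G -> H) :
  topological_group_iso f -> locally_compact_abelian_group G ->
  locally_compact_abelian_group H.
Proof.
move=> [fD fC [g [gK fK gC]]] [GB GT2 Glc].
have gB x y : g (x - y) = g x - g y.
  apply: (canLR gK); rewrite -{1}(fK x) -{1}(fK y).
  have f0 : f 0 = 0 by apply: (addrI (f 0)); rewrite -fD !addr0.
  have fN z : f (- z) = - f z by apply: (addrI (f z)); rewrite -fD !subrr.
  by rewrite -fN -fD.
split.
- rewrite (_ : (fun _ => _) = f \o (fun xy : G * G => xy.1 - xy.2) \o
    (fun xy : H * H => (g xy.1, g xy.2))); last first.
    by apply/funext => -[x y] /=; rewrite -gB fK.
  move=> [x y]; apply: continuous_comp; last first.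
    by apply: continuous_comp; [exact: GB|exact: fC].
  have g1 : {for (x, y), continuous (fun xy : H * H => g xy.1)}.
    by apply: (@continuous_comp _ _ _ fst g); [exact: cvg_fst|exact: gC].
  have g2 : {for (x, y), continuous (fun xy : H * H => g xy.2)}.
    by apply: (@continuous_comp _ _ _ snd g); [exact: cvg_snd|exact: gC].
  exact: (cvg_pair g1 g2).
- move=> x y xy; apply: (can_inj fK); apply: GT2 => A B /gC Ax /gC By.
  by have [z [Az Bz]] := xy _ _ Ax By; exists (g z).
- move=> x _; have [A Ax [Ac Acl]] := Glc (g x) I.
  have gxA : nbhs (g x) A.
    by apply: (@filterS _ (nbhs (g x)) _ _ _ _ Ax) => y; exact.
  exists (g @^-1` A).
    apply: (@filterS _ (nbhs x) _ (g @^-1` A)) => [y + _|] //; exact: gC.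
  split; last by apply: preimage_closed.
  (* The same set is closed as a preimage under [g] and compact as an image under [f]. *)
  rewrite (_ : g @^-1` A = f @` A).
    by apply: continuous_compact Ac; exact: continuous_subspaceT.
  apply/seteqP; split=> [y Ay|_ [y Ay <-]]; last by rewrite /= gK.
  by exists (g y).
Qed.

Theorem theorem3p5 (R : realType) :
  [/\ locally_compact_abelian_group finite_adele,
      locally_compact_abelian_group (Char R finite_adele) &
      exists Phi : finite_adele -> Char R finite_adele,
        (forall xi x : finite_adele, char_fun (Phi xi) x = chi R (xi * x)) /\
        topological_group_iso Phi].
Proof.
split; first exact: adele_lca.
  exact: lca_iso (chi_char_iso R) adele_lca.
by exists (chi_char R); split=> //; exact: chi_char_iso.
Qed.
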